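(* Let $K$ be an algebraically closed field of characteristic $0$, let $C\subset\mathbb{P}^2$ be an irreducible plane curve over $K$ of degree $d\ge 4$, and let $P\in\mathbb{P}^2$. If $P$ is extendable quasi-Galois for $C$, then $\overline{\overline{P}}=P$ and $G_0[P]\cong G_0[\overline{P}]$.
   Context: For an irreducible plane curve $D\subset\mathbb{P}^2$ (not a line) and a point $P\in\mathbb{P}^2$, let $\pi_P:D\dashrightarrow\mathbb{P}^1$ be the projection from $P$, $G[P]=\{\tau\in\mathrm{Bir}(D)\mid \pi_P\circ\tau=\pi_P\}$, and let $G_0[P]\subset G[P]$ be the subgroup of elements which are restrictions to $D$ of linear transformations of the ambient plane. $P$ is extendable quasi-Galois for $D$ if $|G_0[P]|\ge 2$. Let $C^*\subset\mathbb{P}^{2*}$ be the dual curve of $C$, i.e. the closure of the image of the dual (Gauss) map $\gamma:C\dashrightarrow\mathbb{P}^{2*}$, $Q\mapsto T_QC$; since the characteristic is $0$, $\gamma$ is birational onto $C^*$ and $C^{**}=C$ (under $\mathbb{P}^{2**}=\mathbb{P}^2$). For $\sigma\in\mathrm{Bir}(C)$, write $\overline{\sigma}=\gamma\circ\sigma\circ\gamma^{-1}\in\mathrm{Bir}(C^* )$. If $P$ is extendable quasi-Galois for $C$, there is a unique point $\overline{P}\in\mathbb{P}^{2*}$ such that $\sigma\mapsto\overline{\sigma}$ induces an injection $G_0[P]\hookrightarrow G_0[\overline{P}]$, where $G_0[\overline{P}]$ is taken with respect to $C^*$; this defines $\overline{P}$, which is then extendable quasi-Galois for $C^*$. $\overline{\overline{P}}\in\mathbb{P}^{2**}=\mathbb{P}^2$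 is obtained by applying the same construction to $\overline{P}$ and $C^*$ (with $C^{**}=C$). *)

(* Defs.v *)
From HB Require Import structures.
From mathcomp Require Import all_boot all_order all_algebra.
From mathcomp Require Import boolp classical_sets functions.
From mathcomp Require Import mpoly.

Set Implicit Arguments.
Unset Strict Implicit.
Unset Printing Implicit Defensive.

Import GRing.Theory.
Local Open Scope classical_set_scope.
Local Open Scope ring_scope.

(** ** The projective plane *)

(* A point of P^2 is a line through the origin of K^3.  The dual plane P^2* is
   identified with P^2 by means of the coordinates of linear forms: the line
   a_0 x_0 + a_1 x_1 + a_2 x_2 = 0 is the point [a_0 : a_1 : a_2].  Under this
   convention P^2** is P^2 itself. *)
Record pplane (K : fieldType) := PPoint {
  pline :> {vspace 'rV[K]_3};
  _ : \dim pline == 1%N }.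

HB.instance Definition _ (K : fieldType) := [isSub for @pline K].
HB.instance Definition _ (K : fieldType) := [Choice of pplane K by <:].

(* [v] is a vector of homogeneous coordinates of [Q]; as [pline Q] has
   dimension 1, this forces [v != 0]. *)
Definition hcoord (K : fieldType) (Q : pplane K) (v : 'rV[K]_3) : Prop :=
  pline Q = <[v]>%VS.

Fact dim_e0 (K : fieldType) :
  \dim <[(delta_mx 0 0)%R : 'rV[K]_3]>%VS == 1%N.
Proof.
rewrite dim_vline eqb1.
by apply/eqP => /matrixP/(_ 0 0)/eqP; rewrite !mxE !eqxx oner_eq0.
Qed.

Definition pt0 (K : fieldType) : pplane K := PPoint (dim_e0 K).

Definition eval (K : fieldType) (F : {mpoly K[3]}) (v : 'rV[K]_3) : K :=
  F.@[fun i => v 0 i].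

(** ** Zariski topology *)

Definition vanish (K : fieldType) (F : {mpoly K[3]}) (Q : pplane K) : Prop :=
  forall v, hcoord Q v -> eval F v = 0.

Definition zclosure (K : fieldType) (A : set (pplane K)) : set (pplane K) :=
  [set Q | forall (e : nat) (F : {mpoly K[3]}), F \is e.-homog ->
     (forall R, A R -> vanish F R) -> vanish F Q].

Definition zclosed (K : fieldType) (A : set (pplane K)) : Prop :=
  zclosure A = A.

Definition dense_open (K : fieldType) (D U : set (pplane K)) : Prop :=
  (exists2 Z, zclosed Z & U = D `\` Z) /\ D `<=` zclosure U.

(** ** Plane curves *)

Definition irreducible_form (K : fieldType) (d : nat) (F : {mpoly K[3]}) :
    Prop :=
  [/\ F \is d.-homog, F != 0, F \isn't a GRing.unit &
      forall G H : {mpoly K[3]}, F = G * H ->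
        G \is a GRing.unit \/ H \is a GRing.unit].

Definition curve_of (K : fieldType) (F : {mpoly K[3]}) : set (pplane K) :=
  [set Q | vanish F Q].

Definition irreducible_plane_curve (K : fieldType) (d : nat)
    (C : set (pplane K)) : Prop :=
  exists2 F, irreducible_form d F & C = curve_of F.

(** ** Rational maps *)

(* Partial maps are relations; a rational map on [D] is stored with its maximal
   domain of definition, as the relation [rext D f] below.  Equality of rational
   maps on [D] (agreement on a dense open subset) is thus plain equality. *)
Definition prel (K : fieldType) (T : Type) := pplane K -> T -> Prop.

Definition agree (K : fieldType) (T : Type) (D : set (pplane K))
    (f g : prel K T) : Prop :=
  exists2 U, dense_open D U & forall Q R, U Q -> (f Q R <-> g Q R).

Definition relcomp (K : fieldType) (T : Type)
    (g : prel K T) (f : prel K (pplane K)) : prel K T :=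
  fun Q S => exists2 R, f Q R & g R S.

Definition relinv (K : fieldType) (f : prel K (pplane K)) :
    prel K (pplane K) :=
  fun R Q => f Q R.

(* [Q] is sent to [r_0(Q) : r_1(Q) : r_2(Q)], provided the [r_i(Q)] do not all
   vanish. *)
Definition formmap (K : fieldType) (r : 'I_3 -> {mpoly K[3]}) :
    prel K (pplane K) :=
  fun Q R => exists2 v, hcoord Q v & hcoord R (\row_i eval (r i) v).

(* The extension of [f] to its maximal domain in [D]; it is the empty relation
   if [f] does not agree with forms of the same degree on a dense open subset
   of [D]. *)
Definition rext (K : fieldType) (D : set (pplane K))
    (f : prel K (pplane K)) : prel K (pplane K) :=
  fun Q R => D Q /\ exists r : 'I_3 -> {mpoly K[3]},
    [/\ exists e : nat, forall i, r i \is e.-homog,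
        agree D f (formmap r) & formmap r Q R].

Definition rational_map (K : fieldType) (D E : set (pplane K))
    (f : prel K (pplane K)) : Prop :=
  f = rext D f /\
  exists2 U, dense_open D U & forall Q, U Q -> exists2 R, E R & f Q R.

Definition rid (K : fieldType) (D : set (pplane K)) : prel K (pplane K) :=
  rext D (fun Q R => Q = R).

Definition rcomp (K : fieldType) (D : set (pplane K))
    (g f : prel K (pplane K)) : prel K (pplane K) :=
  rext D (relcomp g f).

Definition Bir (K : fieldType) (D : set (pplane K)) :
    set (prel K (pplane K)) :=
  [set f | rational_map D D f /\
     exists g, [/\ rational_map D D g, rcomp D g f = rid D
                 & rcomp D f g = rid D]].

(** ** The groups G[P] and G_0[P] *)

(* The projection from [P] sends [Q != P] to the line PQ, seen as a plane of K^3;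
   P^1 is the pencil of lines through [P]. *)
Definition proj_from (K : fieldType) (P : pplane K) :
    prel K {vspace 'rV[K]_3} :=
  fun Q L => Q != P /\ L = (pline P + pline Q)%VS.

Definition G (K : fieldType) (D : set (pplane K)) (P : pplane K) :
    set (prel K (pplane K)) :=
  [set tau | Bir D tau /\
     agree D (relcomp (proj_from P) tau) (proj_from P)].

Definition linmap (K : fieldType) (A : 'M[K]_3) : prel K (pplane K) :=
  fun Q R => exists2 v, hcoord Q v & hcoord R (v *m A).

Definition G0 (K : fieldType) (D : set (pplane K)) (P : pplane K) :
    set (prel K (pplane K)) :=
  [set tau | G D P tau /\
     exists2 A : 'M[K]_3, A \in unitmx & agree D tau (linmap A)].

Definition extendable_quasi_Galois (K : fieldType) (D : set (pplane K))
    (P : pplane K) : Prop :=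
  exists sigma tau, [/\ G0 D P sigma, G0 D P tau & sigma <> tau].

(* The groups live in [Bir D] and [Bir E], with composition of rational maps. *)
Definition group_isomorphic (K : fieldType) (D E : set (pplane K))
    (A B : set (prel K (pplane K))) : Prop :=
  exists2 phi : prel K (pplane K) -> prel K (pplane K), set_bij A B phi &
    forall sigma tau, A sigma -> A tau ->
      phi (rcomp D sigma tau) = rcomp E (phi sigma) (phi tau).

(** ** Dual curve and dual point *)

(* [Q] is a smooth point of the irreducible curve [D] and [L] is the tangent
   line to [D] at [Q], whose coordinates are the partial derivatives at [Q] of
   an irreducible equation of [D]. *)
Definition gauss (K : fieldType) (D : set (pplane K)) : prel K (pplane K) :=
  fun Q L => D Q /\ exists d F,
    [/\ irreducible_form d F, D = curve_of F
      & exists2 v, hcoord Q v & hcoord L (\row_i eval F^`M(i) v)].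

Definition dual_curve (K : fieldType) (D : set (pplane K)) :
    set (pplane K) :=
  zclosure [set L | exists Q, gauss D Q L].

Definition bar_map (K : fieldType) (D : set (pplane K))
    (sigma : prel K (pplane K)) : prel K (pplane K) :=
  rext (dual_curve D)
    (relcomp (gauss D) (relcomp sigma (relinv (gauss D)))).

Definition is_bar_point (K : fieldType) (D : set (pplane K))
    (P P' : pplane K) : Prop :=
  set_fun (G0 D P) (G0 (dual_curve D) P') (bar_map D) /\
  set_inj (G0 D P) (bar_map D).

(* [pt0] is a junk value, taken when no point satisfies [is_bar_point]. *)
Definition bar_point (K : fieldType) (D : set (pplane K)) (P : pplane K) :
    pplane K :=
  xget (pt0 K) [set P' | is_bar_point D P P'].

(* Main.v *)
(* Write P = [p]. An element of G_0[P] is the restriction of a linear map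
   preserving the lines through P; after scaling it is v |-> v (1 + xi p) with
   xi a column vector. As the characteristic is 0, the equation of C is not
   invariant under an elation, so pairing p with xi gives a nonzero number when
   xi <> 0 (a homology), and commutators being elations, all elements of G_0[P]
   have the same axis [xi]. The tangent lines are moved by the inverse transpose
   1 - c p^T xi^T, which is a homology with centre [xi^T] and axis [p^T]: hence
   the dual point of P is [xi^T], and dualizing twice gives back P.

   This needs C** = C. The equation F' of C* generates the ideal of the forms H
   such that F divides H(grad F); F' exists by a dimension count, and it spans
   the ideal because eliminating a variable from F' and an element prime to it
   would give a binary form, hence, as this form splits, a linear relation
   between two partial derivatives of F, which cannot hold. With D
   a derivation killing F, both Q and grad F'(grad F(Q)) are orthogonal to the
   vectors grad F(Q) and D(grad F)(Q), which are generically independent, so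
   that they are proportional. *)
From HB Require Import structures.
Require Import Defs.
From mathcomp Require Import all_boot all_order all_algebra.
From mathcomp Require Import boolp classical_sets functions.
From mathcomp Require Import mpoly.
From mathcomp Require Import zify ring.

Set Implicit Arguments.
Unset Strict Implicit.
Unset Printing Implicit Defensive.

Import GRing.Theory.
Local Open Scope classical_set_scope.
Local Open Scope ring_scope.

(** * Gauss' lemma *)

(** Vanishing on the cone over the curve in K^3 is turned into divisibility by the Nullstellensatz
    for one irreducible polynomial, which rests on irreducible polynomials being prime. Primality
    also carries the generic arguments: an identity known only where an auxiliary form is nonzero is
    multiplied by that form, which is then cancelled modulo the equation of the curve. The obstacle
    is symmetry. The argument for the curve has to run again for its dual, and there it needs degree
    at least 3: equality of two linear maps on the curve and preservation of the lines through a
    point are tested by quadratic forms, which must be zero as soon as they vanish on the curve.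
    Hence the dual has to be shown not to be a conic, and [dual_pair] collects facts symmetric in
    the two equations. The derivation of the last step is the one with coefficients taken from the
    partial derivatives of F; that gradients are generically independent from their derivatives is
    the content of [curvature]. *)

Section Primes.
Variable R : idomainType.
Implicit Types a b c p : R.

Definition divides a b := exists c, b = a * c.

Definition irreducible_elt p :=
  [/\ p != 0, p \isn't a GRing.unit
    & forall a b, p = a * b -> a \is a GRing.unit \/ b \is a GRing.unit].

Definition prime_elt p :=
  p != 0 /\ forall a b, divides p (a * b) -> divides p a \/ divides p b.

(** An inductive predicate, so that [gauss_descent] can peel off one prime at a time. *)
Inductive prime_product : R -> Prop :=
| PrimeProductUnit c : c \is a GRing.unit -> prime_product c
| PrimeProductMul p c :
    prime_elt p -> prime_product c -> prime_product (p * c).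

Lemma prime_product_mul a b :
  prime_product a -> prime_product b -> prime_product (a * b).
Proof.
move=> Ha Hb; elim: Ha => {a} [c Uc|p c Pp _ IH].
  elim: Hb => {b} [d Ud|p d Pp _ IH].
    by apply: PrimeProductUnit; rewrite unitrM Uc Ud.
  by rewrite mulrCA; apply: PrimeProductMul.
by rewrite -mulrA; apply: PrimeProductMul.
Qed.

End Primes.

Lemma horner_map_lincomb0 (A B : comNzRingType) (f : {rmorphism A -> B})
    (a p b q : {poly A}) t :
  (map_poly f p).[t] = 0 -> (map_poly f q).[t] = 0 ->
  (map_poly f (a * p + b * q)).[t] = 0.
Proof.
by move=> p0 q0; rewrite rmorphD !rmorphM hornerD !hornerM p0 q0 !mulr0 addr0.
Qed.

Section Transport.
Variables (A B : idomainType) (f : {rmorphism A -> B}) (g : B -> A).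
Hypotheses (fK : cancel f g) (gK : cancel g f).

Lemma unit_iso x : (f x \is a GRing.unit) = (x \is a GRing.unit).
Proof.
apply/idP/idP => [/unitrP[y [yx xy]]|]; last exact: rmorph_unit.
apply/unitrP; exists (g y).
by split; apply: (can_inj fK); rewrite rmorphM rmorph1 gK.
Qed.

Lemma irreducible_iso p : irreducible_elt p -> irreducible_elt (f p).
Proof.
move=> [p0 Np Hp]; split; first by rewrite -(rmorph0 f) (can_eq fK).
  by rewrite unit_iso.
move=> a b E; rewrite -[a]gK -[b]gK !unit_iso; apply: Hp.
by apply: (can_inj fK); rewrite rmorphM !gK.
Qed.

Lemma divides_iso p q : divides (f p) (f q) -> divides p q.
Proof.
by move=> [r E]; exists (g r); apply: (can_inj fK); rewrite rmorphM gK.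
Qed.

Lemma prime_iso p : prime_elt (f p) -> prime_elt p.
Proof.
move=> [p0 Hp]; split; first by move: p0; rewrite -(rmorph0 f) (can_eq fK).
move=> a b [c abE]; case: (Hp (f a) (f b)) => [|/divides_iso|/divides_iso].
- by exists (f c); rewrite -!rmorphM abE.
- by left.
- by right.
Qed.

End Transport.

Section PolyPrimes.
Variable R : idomainType.
Implicit Types (a b c p : R) (f g h : {poly R}).

Lemma divides_polyC p f :
  (forall i, divides p f`_i) -> exists g, f = p *: g.
Proof.
move=> H; exists (\poly_(i < size f) projT1 (cid (H i))).
apply/polyP => i; rewrite coefZ coef_poly.
by case: ltnP => [_|/(nth_default 0)->]; [case: cid | rewrite mulr0].
Qed.

(** Gauss' lemma for one prime: [p] divides the product of the leading coefficients, hence one of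
    them. Subtracting that leading term lowers [size f + size g] and changes [f * g] by a multiple
    of [p]. *)
Lemma prime_elt_coef p f g : prime_elt p ->
  (forall i, divides p (f * g)`_i) ->
  (forall i, divides p f`_i) \/ (forall i, divides p g`_i).
Proof.
move=> [p0 Pp].
have d0 : divides p 0 by exists 0; rewrite mulr0.
have dB a b : divides p a -> divides p b -> divides p (a - b).
  by move=> [x ->] [y ->]; exists (x - y); rewrite mulrBr.
have dD a b : divides p a -> divides p b -> divides p (a + b).
  by move=> [x ->] [y ->]; exists (x + y); rewrite mulrDr.
have dM a b : divides p a -> divides p (a * b).
  by move=> [x ->]; exists (x * b); rewrite mulrA.
have top (q : {poly R}) : divides p (lead_coef q) ->
    (forall i, divides p (q - lead_coef q *: 'X^((size q).-1))`_i) ->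
    forall i, divides p q`_i.
  move=> dl dq i; have := dD _ _ (dq i) (dM _ ('X^((size q).-1))`_i dl).
  by rewrite coefB coefZ subrK.
have szlt (q : {poly R}) : q != 0 ->
    (size (q - lead_coef q *: 'X^((size q).-1))%R < size q)%N.
  move=> q0; have sq : (0 < size q)%N by rewrite size_poly_gt0.
  rewrite -[X in (_ < X)%N](prednK sq) ltnS; apply/leq_sizeP => j lj.
  rewrite coefB coefZ coefXn; case: eqP => [->|/eqP ne].
    by rewrite mulr1 subrr.
  rewrite mulr0 subr0 nth_default // -(prednK sq) ltn_neqAle eq_sym ne.
  by rewrite lj.
move: {2}(size f + size g)%N (leqnn (size f + size g)) => n.
elim: n f g => [|n IH] f g.
  rewrite leqn0 addn_eq0 size_poly_eq0 => /andP[/eqP-> _] _.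
  by left=> i; rewrite coef0.
move=> len dfg.
have [->|f0] := eqVneq f 0; first by left=> i; rewrite coef0.
have [->|g0] := eqVneq g 0; first by right=> i; rewrite coef0.
have /Pp[dl|dl] : divides p (lead_coef f * lead_coef g).
- by rewrite -lead_coefM lead_coefE.
- case: (IH (f - lead_coef f *: 'X^((size f).-1)) g).
  + by rewrite -ltnS (leq_trans _ len) // ltn_add2r szlt.
  + move=> i; rewrite mulrBl coefB; apply: dB => //.
    by rewrite -scalerAl coefZ; apply: dM.
  + by move=> H; left; apply: top.
  + by right.
- case: (IH f (g - lead_coef g *: 'X^((size g).-1))).
  + by rewrite -ltnS (leq_trans _ len) // ltn_add2l szlt.
  + move=> i; rewrite mulrBr coefB; apply: dB => //.
    by rewrite -scalerAr coefZ; apply: dM.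
  + by left.
  + by move=> H; right; apply: top.
Qed.

Lemma prime_elt_polyC p : prime_elt p -> prime_elt p%:P.
Proof.
move=> Pp; split; first by rewrite polyC_eq0; case: Pp.
have dP f : (forall i, divides p f`_i) -> divides p%:P f.
  by case/divides_polyC => g ->; exists g; rewrite mul_polyC.
move=> f g [h fgE]; case: (@prime_elt_coef p f g Pp) => [i|/dP|/dP]; auto.
by rewrite fgE coefCM; exists h`_i.
Qed.

Lemma unit_polyC a : (a%:P \is a GRing.unit) = (a \is a GRing.unit).
Proof.
rewrite poly_unitE size_polyC coefC eqxx.
by have [->|_] := eqVneq a 0; rewrite ?unitr0 ?andbF.
Qed.

Lemma irreducible_polyC c : irreducible_elt c%:P -> irreducible_elt c.
Proof.
move=> [c0 Nc Hc]; split; first by move: c0; rewrite polyC_eq0.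
  by rewrite -unit_polyC.
move=> a b E; rewrite -(unit_polyC a) -(unit_polyC b); apply: Hc.
by rewrite E polyCM.
Qed.

(** Each prime factor of [c] divides [g] or [h] and is cancelled there. This clears the denominators
    of a factorization over the fraction field. *)
Lemma gauss_descent c f g h : prime_product c -> c *: f = g * h ->
  exists a b, [/\ a != 0, b != 0 &
    exists g' h', [/\ f = g' * h', g = a *: g' & h = b *: h']].
Proof.
move=> Hc; elim: Hc g h => {c} [c Uc|p c Pp Hc IH] g h E.
  have c0 : c != 0 by apply: contraTneq Uc => ->; rewrite unitr0.
  exists c, 1; rewrite oner_eq0; split=> //.
  exists (c^-1 *: g), h; rewrite scale1r scalerA mulrV // scale1r; split=> //.
  by rewrite -scalerAl -E scalerA mulVr // scale1r.
have p0 : p != 0 by case: Pp.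
have injp : injective (fun q : {poly R} => p *: q).
  move=> q1 q2 /eqP; rewrite -subr_eq0 -scalerBr -mul_polyC mulf_eq0 polyC_eq0.
  by rewrite (negbTE p0) subr_eq0 => /eqP.
case: (@prime_elt_coef p g h Pp).
- by move=> i; rewrite -E -scalerA coefZ; exists ((c *: f)`_i).
- case/divides_polyC => g1 gE; case: (IH g1 h).
    by apply: injp; rewrite scalerA E gE scalerAl.
  move=> a [b [a0 b0 [g' [h' [-> g1E ->]]]]].
  exists (p * a), b; rewrite mulf_neq0 //; split=> //.
  by exists g', h'; split=> //; rewrite gE g1E scalerA.
- case/divides_polyC => h1 hE; case: (IH g h1).
    by apply: injp; rewrite scalerA E hE scalerAr.
  move=> a [b [a0 b0 [g' [h' [-> -> h1E]]]]].
  exists a, (p * b); rewrite mulf_neq0 //; split=> //.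
  by exists g', h'; split=> //; rewrite hE h1E scalerA.
Qed.

Hypothesis irreducible_primeR : forall p, irreducible_elt p -> prime_elt p.
Hypothesis prime_productR : forall c, c != 0 -> prime_product c.

(** Irreducibility and positive degree force the constant that [gauss_descent] splits off from [f]
    to be a unit. *)
Lemma irreducible_divides_scale c f g : irreducible_elt f -> (1 < size f)%N ->
  c != 0 -> divides f (c *: g) -> divides f g.
Proof.
move=> [f0 _ irrf] sf c0 [h cgE].
have [a [b [a0 b0 [f' [h' [-> fE _]]]]]] :=
  gauss_descent (prime_productR c0) cgE.
have := irrf a%:P f'; rewrite mul_polyC => /(_ fE)[|].
  rewrite unit_polyC => Ua; exists (a^-1 *: h').
  by rewrite fE -scalerAl -scalerAr scalerA mulrV ?scale1r.
move: sf; rewrite fE size_scale // => sf'.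
by rewrite poly_unitE gtn_eqF.
Qed.

(** The pseudo-gcd divides [f] up to a constant. After [gauss_descent], either the cofactor is a
    unit, and [f] divides [g], or the gcd is constant, and a Bezout relation provides [c]. *)
Lemma irreducible_divides_or_coprime f g : irreducible_elt f ->
  (1 < size f)%N ->
  divides f g \/ exists2 c, c != 0 & exists u v, c%:P = u * f + v * g.
Proof.
move=> irrf sf; have [f0 Nf Hf] := irrf.
have /Pdiv.Idomain.dvdpP[[c1 k1] /= c10 E1] := dvdp_gcdl f g.
have /Pdiv.Idomain.dvdpP[[c2 k2] /= c20 E2] := dvdp_gcdr f g.
have [a [b [a0 b0 [k1' [e' [fE k1E eE]]]]]] :=
  gauss_descent (prime_productR c10) E1.
case: (Hf _ _ fE) => [Uk|Ue]; [left | right].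
  move: Uk; rewrite poly_unitE => /andP[/eqP sk Uk].
  have k1'E : k1' = (k1'`_0)%:P by apply: size1_polyC; rewrite sk.
  set u := k1'`_0 in Uk k1'E.
  apply: (@irreducible_divides_scale c2) => //.
  exists (b *: (u^-1 *: k2)).
  rewrite E2 eE fE k1'E mul_polyC -!scalerAl -!scalerAr !scalerA.
  by rewrite (mulrC u) -mulrA mulVr // mulr1 mulrC.
have : coprimep f g.
  rewrite coprimep_def eE size_scale //.
  by move: Ue; rewrite poly_unitE => /andP[].
case/Bezout_coprimepP => -[u v] /= /eqpP[[c c'] /= /andP[c0 c'0] E].
exists c' => //; exists (c *: u), (c *: v).
by rewrite -!scalerAl -scalerDr E alg_polyC.
Qed.

(** Constants are settled in [R]. In positive degree, if [f] does not divide [g], then [c *: h]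
    equals [(u * f + v * g) * h], a multiple of [f] whenever [g * h] is one. *)
Lemma irreducible_prime_poly f : irreducible_elt f -> prime_elt f.
Proof.
move=> irrf; have [f0 Nf Hf] := irrf.
have [sf|sf] := leqP (size f) 1.
  have fE := size1_polyC sf; rewrite fE.
  by apply/prime_elt_polyC/irreducible_primeR/irreducible_polyC; rewrite -fE.
split=> // g h [k ghE].
have [|[c c0 [u [v E]]]] := irreducible_divides_or_coprime g irrf sf.
  by left.
right; apply: (@irreducible_divides_scale c) => //.
exists (u * h + v * k).
by rewrite -mul_polyC E mulrDl mulrDr -!mulrA ghE; congr (_ + _);
   rewrite mulrCA.
Qed.

End PolyPrimes.

(** * Hypersurfaces in affine space *)

Section MPolyGenerators.
Variables (n : nat) (R : comNzRingType).

Lemma mpoly_gen_ind (P : {mpoly R[n]} -> Prop) :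
  (forall c, P c%:MP) -> (forall i, P 'X_i) ->
  (forall p q, P p -> P q -> P (p + q)) ->
  (forall p q, P p -> P q -> P (p * q)) ->
  forall p, P p.
Proof.
move=> PC PX PD PM p; rewrite [p]mpolyE.
apply: (big_ind P) => [||m _]; [by rewrite -mpolyC0 | exact: PD |].
rewrite -mul_mpolyC mpolyXE_id; apply: (PM) => //.
apply: (big_ind P) => [||i _]; [by rewrite -mpolyC1 | exact: (PM) |].
by elim: (m i) => [|k IH]; rewrite ?expr0 -?mpolyC1 // exprS; apply: (PM).
Qed.

End MPolyGenerators.

Section Uni.
Variables (n : nat) (R : comNzRingType).

Let wd := widen_ord (leqnSn n).

Lemma muni_widen (i : 'I_n) : muni ('X_(wd i) : {mpoly R[n.+1]}) = ('X_i)%:P.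
Proof.
rewrite /muni mmapX mmap1U; case: splitP => [j /= E|j /= E].
  by congr ('X__)%:P; apply/val_inj.
by move: (ltn_ord i); rewrite E ord1 addn0 ltnn.
Qed.

Lemma muni_max : muni ('X_ord_max : {mpoly R[n.+1]}) = 'X.
Proof.
rewrite /muni mmapX mmap1U; case: splitP => [j /= E|//].
by move: (ltn_ord j); rewrite -E ltnn.
Qed.

Definition multi_of_uni (q : {poly {mpoly R[n]}}) : {mpoly R[n.+1]} :=
  (map_poly (@mwiden n R) q).['X_ord_max].

Lemma multi_of_uniD p q :
  multi_of_uni (p + q) = multi_of_uni p + multi_of_uni q.
Proof. by rewrite /multi_of_uni rmorphD hornerD. Qed.

Lemma multi_of_uniM p q :
  multi_of_uni (p * q) = multi_of_uni p * multi_of_uni q.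
Proof. by rewrite /multi_of_uni rmorphM hornerM. Qed.

Lemma ord_max_or_widen (i : 'I_n.+1) : i = ord_max \/ exists j, i = wd j.
Proof.
have := ltn_ord i; rewrite ltnS leq_eqVlt => /orP[/eqP E|lt].
  by left; apply: val_inj.
by right; exists (Ordinal lt); apply: val_inj.
Qed.

Lemma muniK : cancel (@muni n R) multi_of_uni.
Proof.
move=> p; elim/mpoly_gen_ind: p => [c|i|p q Ep Eq|p q Ep Eq].
- by rewrite muniC /multi_of_uni map_polyC hornerC /= mwidenC.
- case: (ord_max_or_widen i) => [->|[j ->]].
    by rewrite muni_max /multi_of_uni map_polyX hornerX.
  rewrite muni_widen /multi_of_uni map_polyC hornerC /=.
  by rewrite /mwiden mmapX mmap1U.
- by rewrite muniD multi_of_uniD; congr (_ + _); [exact: Ep | exact: Eq].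
- by rewrite muniM multi_of_uniM; congr (_ * _); [exact: Ep | exact: Eq].
Qed.

Lemma muni_mwiden (p : {mpoly R[n]}) : muni (mwiden p) = p%:P.
Proof.
elim/mpoly_gen_ind: p => [c|i|p q Ep Eq|p q Ep Eq].
- by rewrite mwidenC muniC.
- by rewrite /mwiden mmapX mmap1U muni_widen.
- by rewrite mwidenD muniD polyCD; congr (_ + _); [exact: Ep | exact: Eq].
- by rewrite mwidenM muniM polyCM; congr (_ * _); [exact: Ep | exact: Eq].
Qed.

Lemma multi_of_uniK : cancel multi_of_uni (@muni n R).
Proof.
move=> q; elim/poly_ind: q => [|q c IH].
  by rewrite /multi_of_uni map_poly0 horner0 muni0.
rewrite multi_of_uniD multi_of_uniM muniD muniM IH.
rewrite /multi_of_uni map_polyX hornerX muni_max map_polyC hornerC.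
by rewrite muni_mwiden.
Qed.

Lemma multi_of_uni_lincomb a b p q :
  multi_of_uni (a * muni p + b * muni q) =
    multi_of_uni a * p + multi_of_uni b * q.
Proof.
have E x y : multi_of_uni (a * x + b * y) =
    multi_of_uni a * multi_of_uni x + multi_of_uni b * multi_of_uni y.
  by rewrite multi_of_uniD !multi_of_uniM.
by rewrite (E (muni p) (muni q)); congr (_ * _ + _ * _); exact: muniK.
Qed.

Lemma meval_muni (v : 'I_n.+1 -> R) p :
  p.@[v] = (map_poly (meval (v \o wd)) (muni p)).[v ord_max].
Proof.
elim/mpoly_gen_ind: p => [c|i|p q Ep Eq|p q Ep Eq].
- by rewrite muniC map_polyC hornerC /= !mevalC.
- rewrite mevalXU; case: (ord_max_or_widen i) => [->|[j ->]].
    by rewrite muni_max map_polyX hornerX.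
  by rewrite muni_widen map_polyC hornerC /= mevalXU.
- rewrite mevalD muniD (rmorphD (map_poly (meval (v \o wd)))) hornerD.
  by congr (_ + _); [exact: Ep | exact: Eq].
- rewrite mevalM muniM (rmorphM (map_poly (meval (v \o wd)))) hornerM.
  by congr (_ * _); [exact: Ep | exact: Eq].
Qed.

Definition snoc_point (u : 'I_n -> R) (t : R) (i : 'I_n.+1) : R :=
  oapp u t (unlift ord_max i).

Lemma snoc_point_max u t : snoc_point u t ord_max = t.
Proof. by rewrite /snoc_point unlift_none. Qed.

Lemma snoc_point_widen u t i : snoc_point u t (wd i) = u i.
Proof.
rewrite /snoc_point (_ : wd i = lift ord_max i) ?liftK //.
by apply: val_inj; rewrite /= /bump leqNgt ltn_ord.
Qed.

Lemma meval_snoc_point u t p :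
  p.@[snoc_point u t] = (map_poly (meval u) (muni p)).[t].
Proof.
rewrite meval_muni snoc_point_max; congr (_.[_]).
by apply: eq_map_poly => q; apply: meval_eq => i; rewrite /= snoc_point_widen.
Qed.

End Uni.

(** * Irreducible polynomials over a field are prime *)

Section Factorization.
Variable K : fieldType.

Lemma mpoly_unit_msize n (p : {mpoly K[n]}) :
  (p \is a GRing.unit) = (msize p == 1)%N.
Proof.
apply/idP/idP => [/andP[/eqP pE Up]|/msize_poly1P[c c0 ->]].
  rewrite pE msizeC; suff -> : p@_0%MM != 0 by [].
  by apply: contraTneq Up => ->; rewrite unitr0.
by apply/andP; rewrite mcoeffC eqxx mulr1 unitfE.
Qed.

(** Induction on the total degree: a nonunit that is not irreducible splits into two factors of
    smaller [msize]. *)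
Lemma prime_product_mpoly n :
  (forall p : {mpoly K[n]}, irreducible_elt p -> prime_elt p) ->
  forall c : {mpoly K[n]}, c != 0 -> prime_product c.
Proof.
move=> H c; move: {2}(msize c) (leqnn (msize c)) => k.
elim: k c => [|k IH] c; first by rewrite leqn0 msize_poly_eq0 => ->.
move=> sc c0; have [Uc|Nc] := boolP (c \is a GRing.unit).
  exact: PrimeProductUnit.
have [irr|red] := pselect (irreducible_elt c).
  rewrite -[c]mulr1; apply: PrimeProductMul; first exact: H.
  by apply: PrimeProductUnit; rewrite unitr1.
have [a [b [cE Na Nb]]] : exists a b,
    [/\ c = a * b, a \isn't a GRing.unit & b \isn't a GRing.unit].
  apply: contrapT => nex; apply: red; split=> // a b cE.
  by have [|Na] := boolP (a \is a GRing.unit); [left | right];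
     apply/negPn/negP => Nb; apply: nex; exists a, b.
have [a0 b0] : a != 0 /\ b != 0.
  by move: c0; rewrite cE mulf_eq0 negb_or => /andP.
have big (q : {mpoly K[n]}) : q != 0 -> q \isn't a GRing.unit ->
    (1 < msize q)%N.
  move=> q0; rewrite mpoly_unit_msize ltn_neqAle eq_sym => ->.
  by rewrite lt0n msize_poly_eq0.
have := sc; rewrite cE msizeM // => sab.
have sa := big _ a0 Na; have sb := big _ b0 Nb.
apply: prime_product_mul; apply: IH => //; rewrite -ltnS;
  apply: leq_trans sab.
  by rewrite -(prednK (ltnW sb)) addnS /= -addn1 leq_add2l -ltnS prednK // ltnW.
by rewrite -(prednK (ltnW sa)) addSn /= -add1n leq_add2r -ltnS prednK // ltnW.
Qed.

Lemma irreducible_muni n (p : {mpoly K[n.+1]}) :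
  irreducible_elt p -> irreducible_elt (muni p).
Proof. exact: (irreducible_iso (@muniK n K) (@multi_of_uniK n K)). Qed.

Lemma divides_muni n (p q : {mpoly K[n.+1]}) :
  divides (muni p) (muni q) -> divides p q.
Proof. exact: (divides_iso (@muniK n K) (@multi_of_uniK n K)). Qed.

(** Induction on the number of variables through [muni]; without variables every nonzero polynomial
    is a unit, so nothing is irreducible. *)
Lemma irreducible_prime_mpoly n (p : {mpoly K[n]}) :
  irreducible_elt p -> prime_elt p.
Proof.
elim: n p => [|n IH] p irrp.
  case: irrp => p0 /negP[]; rewrite -(mpolyKC p).
  rewrite rmorph_unit // unitfE; apply: contra_neq p0 => E.
  by rewrite -(mpolyKC p) E.
apply: (prime_iso (@muniK n K) (@multi_of_uniK n K)).
exact: (irreducible_prime_poly IH (prime_product_mpoly IH)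
  (irreducible_muni irrp)).
Qed.

End Factorization.

(** * Nullstellensatz for an irreducible hypersurface *)

Section Nullstellensatz.
Variable K : closedFieldType.

Lemma mpoly_nonroot n (p : {mpoly K[n]}) : p != 0 -> exists v, p.@[v] != 0.
Proof.
elim: n p => [|n IH] p p0.
  exists (fun=> 0); rewrite -(mpolyKC p) mevalC.
  by apply: contra_neq p0 => E; rewrite -(mpolyKC p) E.
have : lead_coef (muni p) != 0.
  by rewrite lead_coef_eq0 -muni0 (can_eq (@muniK _ _)).
case/IH => u lu.
have /closed_nonrootP[t nt] : map_poly (meval u) (muni p) != 0.
  apply: contra_neq lu => /(congr1 (fun q : {poly K} => q`_(size (muni p)).-1)).
  by rewrite coef_map coef0 lead_coefE.
by exists (snoc_point u t); rewrite meval_snoc_point.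
Qed.

Lemma mpoly_ext n (p q : {mpoly K[n]}) : (forall v, p.@[v] = q.@[v]) -> p = q.
Proof.
move=> E; apply/eqP; rewrite -subr_eq0; apply/negPn/negP => /mpoly_nonroot[v].
by rewrite mevalB E subrr eqxx.
Qed.

(** If [f] involves the last variable and does not divide [g], a Bezout relation gives a nonzero [c]
    free of that variable. Over a point [u] where neither [c] nor the leading coefficient of [f]
    vanishes, [f] still has a root, at which [g] and therefore [c] must vanish. *)
Theorem hypersurface_nullstellensatz n (f g : {mpoly K[n]}) :
  irreducible_elt f -> (forall v, f.@[v] = 0 -> g.@[v] = 0) -> divides f g.
Proof.
elim: n f g => [|n IH] f g irrf vfg.
  case: irrf => f0 /negP[]; rewrite -(mpolyKC f).
  rewrite rmorph_unit // unitfE; apply: contra_neq f0 => E.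
  by rewrite -(mpolyKC f) E.
apply: divides_muni; have irrF := irreducible_muni irrf.
have [sf|sf] := leqP (size (muni f)) 1.
  have fE := size1_polyC sf; set f0 := _`_0 in fE.
  case: (@divides_polyC _ f0 (muni g)) => [i|g' ->]; last first.
    by rewrite fE -mul_polyC; exists g'.
  apply: IH; first by apply: irreducible_polyC; rewrite -fE.
  (* Over a zero [u] of [f0] the whole fibre consists of zeros of [f], so [g] restricts to the zero
     polynomial there. *)
  move=> u f0u; have : map_poly (meval u) (muni g) = 0.
    apply/eqP/negPn/negP => /closed_nonrootP[t /negP]; apply; apply/eqP.
    rewrite -meval_snoc_point; apply: vfg.
    by rewrite meval_snoc_point fE map_polyC hornerC.
  by move/(congr1 (fun q : {poly K} => q`_i)); rewrite coef_map coef0.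
have [//|[c c0 [a [b E]]]] := irreducible_divides_or_coprime
  (prime_product_mpoly (@irreducible_prime_mpoly K n)) (muni g) irrF sf.
have l0 : lead_coef (muni f) != 0.
  by rewrite lead_coef_eq0 -muni0 (can_eq (@muniK _ _)); case: irrf.
have /mpoly_nonroot[u] : c * lead_coef (muni f) != 0 by rewrite mulf_neq0.
rewrite mevalM mulf_eq0 negb_or => /andP[cu lu].
have /closed_rootP[t rt] : size (map_poly (meval u) (muni f)) != 1.
  rewrite neq_ltn; apply/orP; right; apply: (leq_trans sf).
  rewrite leqNgt; apply: contraNN lu => lt.
  rewrite lead_coefE -coef_map nth_default // -ltnS prednK //.
  exact: ltnW.
have fv : f.@[snoc_point u t] = 0 by rewrite meval_snoc_point; apply/eqP.
have gv := vfg _ fv.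
rewrite (meval_snoc_point u t f) in fv.
rewrite (meval_snoc_point u t g) in gv.
case/eqP: cu; have := congr1 (fun q => (map_poly (meval u) q).[t]) E.
rewrite /= map_polyC hornerC /= => ->.
exact: (horner_map_lincomb0 a b fv gv).
Qed.

End Nullstellensatz.

(** * Forms in three variables *)

Lemma linear_kernel (F : fieldType) (U V : vectType F) (f : U -> V) :
  linear f -> (dim V < dim U)%N -> exists2 u, u != 0 & f u = 0.
Proof.
move=> flin lt.
pose fL := GRing.isLinear.Build _ _ _ _ f flin.
pose g : {linear U -> V} := HB.pack f fL.
have kg : lker (linfun g) != 0%VS.
  apply: contraTneq lt => E; rewrite -leqNgt.
  have := limg_ker_dim (linfun g) fullv; rewrite E capv0 dimv0 dimvf => <-.
  by rewrite -[X in (_ <= X)%N]dimvf dimvS ?subvf.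
exists (vpick (lker (linfun g))); first by rewrite vpick0.
by have := memv_pick (lker (linfun g)); rewrite memv_ker lfunE => /eqP.
Qed.

Lemma row_neq0 (K : fieldType) (v : 'rV[K]_3) : v != 0 -> exists i, v 0 i != 0.
Proof.
move=> v0; apply: contrapT => nex; case/eqP: v0; apply/rowP => i.
by rewrite mxE; apply: contrapT => /eqP vi; apply: nex; exists i.
Qed.

Section Eval.
Variable K : fieldType.
Implicit Types (F G H : {mpoly K[3]}) (v w : 'rV[K]_3).

Lemma evalD F G v : eval (F + G) v = eval F v + eval G v.
Proof. exact: mevalD. Qed.

Lemma evalB F G v : eval (F - G) v = eval F v - eval G v.
Proof. exact: mevalB. Qed.

Lemma evalM F G v : eval (F * G) v = eval F v * eval G v.
Proof. exact: mevalM. Qed.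

Lemma evalZ c F v : eval (c *: F) v = c * eval F v.
Proof. exact: mevalZ. Qed.

Lemma evalC c v : eval c%:MP v = c.
Proof. exact: mevalC. Qed.

Lemma evalX i v : eval 'X_i v = v 0 i.
Proof. exact: mevalXU. Qed.

Lemma eval0 v : eval 0 v = 0.
Proof. exact: meval0. Qed.

Lemma eval_sum (I : Type) (r : seq I) (P : pred I) (E : I -> {mpoly K[3]}) v :
  eval (\sum_(i <- r | P i) E i) v = \sum_(i <- r | P i) eval (E i) v.
Proof. exact: (big_morph _ (fun F G => evalD F G v) (eval0 v)). Qed.

Lemma eval_homog e F t v :
  F \is e.-homog -> eval F (t *: v) = t ^+ e * eval F v.
Proof.
move/dhomogP => hF; rewrite /eval !mevalE mulr_sumr.
apply: eq_big_seq => m /hF; rewrite /= => mE; rewrite mulrCA; congr (_ * _).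
under eq_bigr do rewrite mxE exprMn.
rewrite big_split /=; congr (_ * _).
by rewrite -mE mdegE -expr_sum.
Qed.

Definition subst (f : 'I_3 -> {mpoly K[3]}) H := H \mPo [tuple f i | i < 3].

Lemma eval_subst f H v : eval (subst f H) v = eval H (\row_i eval (f i) v).
Proof.
rewrite /eval /subst comp_mpoly_meval; apply: meval_eq => i.
by rewrite tnth_mktuple mxE.
Qed.

Lemma substD f G H : subst f (G + H) = subst f G + subst f H.
Proof. exact: comp_mpolyD. Qed.

Lemma substZ f c H : subst f (c *: H) = c *: subst f H.
Proof. exact: comp_mpolyZ. Qed.

Lemma subst_homog n e f H : H \is n.-homog -> (forall i, f i \is e.-homog) ->
  subst f H \is (n * e).-homog.
Proof.
move=> /dhomogP hH hf; rewrite /subst comp_mpolyEX big_seq.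
apply: rpred_sum => m /hH /= mE; apply: rpredZ; rewrite comp_mpolyX.
rewrite -mE mdegE big_distrl /=.
apply: (big_ind2 (fun (p : {mpoly K[3]}) k => p \is k.-homog)).
- exact: dhomog1.
- by move=> p1 k1 p2 k2; apply: dhomogM.
- by move=> i _; rewrite tnth_mktuple mulnC; apply: dhomogMn.
Qed.

(** With [n = 2 * e * d], forms of degree [n * e] modulo multiples of a form of degree [d] have
    dimension about [d * n * e], and forms of degree [n] about [n ^ 2 / 2]. This [n] makes the two
    leading terms equal, and the lower ones decide. *)
Lemma bin_count e d : (0 < e)%N -> (0 < d)%N ->
  ('C((2 * e * d) * e + 2, (2 * e * d) * e) <
   'C(2 * e * d + 2, 2 * e * d) +
   'C((2 * e * d) * e - d + 2, (2 * e * d) * e - d))%N.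
Proof.
move=> e0 d0.
have b2 m : ('C(m + 2, m) * 2 = (m + 2) * (m + 1))%N.
  have E : 'C(m + 2, m) = 'C(m + 2, 2) by rewrite -bin_sub ?leq_addr // addKn.
  have := bin_ffact (m + 2) 2.
  by rewrite -E !ffactnS ffactn0 (_ : 2`! = 2)%N //; lia.
rewrite -(ltn_pmul2r (isT : (0 < 2)%N)) mulnDl !b2.
have dn : (d <= 2 * e * d)%N by rewrite leq_pmull // muln_gt0.
have da : (d <= 2 * e * d * e)%N by rewrite (leq_trans dn) // leq_pmulr.
have nn : (2 * e * d * (2 * e * d) = 2 * d * (2 * e * d * e))%N by lia.
move: dn da nn; set n := (2 * e * d)%N; set a := (n * e)%N => dn da nn.
have [b aE] : exists b, a = (b + d)%N by exists (a - d)%N; rewrite subnK.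
rewrite {}aE in nn da *; rewrite addnK; nia.
Qed.

(** The linear map sending [(H, M)] to [subst f H - F * M] has a nonzero kernel by [bin_count], and
    [H = 0] would force [M = 0]. *)
Lemma relation_exists d e F (f : 'I_3 -> {mpoly K[3]}) :
  F != 0 -> F \is d.-homog -> (0 < d)%N ->
  (forall i, f i \is e.-homog) -> (0 < e)%N ->
  exists n H, [/\ H != 0, H \is n.-homog & exists M, subst f H = F * M].
Proof.
move=> F0 hF d0 hf e0; pose n := (2 * e * d)%N.
have le : (d <= n * e)%N.
  by rewrite /n mulnC !mulnA leq_pmull // !muln_gt0 e0.
pose U := (dhomog 3 K n * dhomog 3 K (n * e - d))%type.
have hP (u : U) : subst f (val u.1) - F * val u.2 \is (n * e).-homog.
  apply: rpredB; first exact: (subst_homog (dhomog_is_dhomog u.1) hf).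
  by have := dhomogM hF (dhomog_is_dhomog u.2); rewrite (subnKC le).
pose P (u : U) : dhomog 3 K (n * e) := DHomog (hP u).
have Plin : linear P.
  move=> c u w; apply: val_inj; rewrite /= substD substZ.
  by rewrite mulrDr -scalerAr scalerBr opprD addrACA.
case: (linear_kernel Plin) => [|[H M] /= u0 /(congr1 val) /= E].
  exact: (bin_count e0 d0).
have {}E : subst f (val H) = F * val M by apply/eqP; rewrite -subr_eq0 E.
exists n, (val H); split; [|exact: dhomog_is_dhomog | by exists (val M)].
apply: contra_neq u0 => H0; rewrite H0 /subst comp_mpoly0 in E.
have M0 : val M = 0.
  by apply/eqP; have /eqP := esym E; rewrite mulf_eq0 (negbTE F0).
by congr pair; apply: val_inj; rewrite /= ?H0 ?M0.
Qed.

End Eval.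

(** * Euler's identity, the chain rule and restriction to lines *)

Section Derivatives.
Variable K : fieldType.
Implicit Types (F G H : {mpoly K[3]}) (v w : 'rV[K]_3).

Lemma mderivXU (i j : 'I_3) : ('X_j : {mpoly K[3]})^`M(i) = (i == j)%:R%:MP.
Proof.
rewrite mderivX mnmE; have [->|ne] := eqVneq i j.
  by rewrite scale1r -{1}[U_(j)%MM]add0m addmK mpolyX0 mpolyC1.
by rewrite scale0r mpolyC0.
Qed.

Lemma mderiv_homog d F i : F \is d.+1.-homog -> F^`M(i) \is d.-homog.
Proof.
move=> hF; apply/dhomogP => m; rewrite mcoeff_msupp mcoeff_deriv => nz.
have {}nz : F@_(m + U_(i)) != 0 by apply: contra_neq nz => ->; rewrite mul0rn.
move/dhomogP: hF => /(_ (m + U_(i))%MM); rewrite mcoeff_msupp => /(_ nz) /=.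
by rewrite mdegD mdeg1 addn1 => -[].
Qed.

Lemma euler d F : F \is d.-homog ->
  \sum_i 'X_i * F^`M(i) = d%:R *: F.
Proof.
move/dhomogP => hF; rewrite {2}[F]mpolyE scaler_sumr.
under eq_bigr => i _ do rewrite {1}[F]mpolyE raddf_sum mulr_sumr /=.
rewrite exchange_big /=; apply: eq_big_seq => m /hF /= <-.
have E i : 'X_i * (F@_m *: 'X_[m])^`M(i) = F@_m *: ((m i)%:R *: 'X_[m]).
  rewrite mderivZ mderivX -!scalerAr -mpolyXD; congr (_ *: _).
  case mi: (m i) => [|k]; first by rewrite !scale0r.
  by congr (_ *: 'X_[_]); rewrite addmC submK // lep1mP mi.
under eq_bigr do rewrite E.
rewrite -scaler_sumr scalerA mulrC -scalerA; congr (_ *: _).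
by rewrite -scaler_suml -natr_sum -mdegE.
Qed.

Lemma mderiv_subst f H j :
  (subst f H)^`M(j) = \sum_i subst f H^`M(i) * (f i)^`M(j).
Proof.
elim/mpoly_gen_ind: H => [c|i|p q Ep Eq|p q Ep Eq].
- rewrite /subst comp_mpolyC mderivC big1 // => i _.
  by rewrite mderivC comp_mpoly0 mul0r.
- rewrite /subst comp_mpolyXU -tnth_nth tnth_mktuple (bigD1 i) //= mderivXU.
  rewrite eqxx comp_mpolyC mpolyC1 mul1r big1 ?addr0 // => k ne.
  by rewrite mderivXU (negbTE ne) comp_mpolyC mpolyC0 mul0r.
- rewrite substD mderivD Ep Eq -big_split; apply: eq_bigr => i _.
  by rewrite mderivD substD mulrDl.
- have substM (a b : {mpoly K[3]}) : subst f (a * b) = subst f a * subst f b.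
    exact: rmorphM.
  rewrite substM mderivM Ep Eq mulr_suml mulr_sumr -big_split.
  apply: eq_bigr => i _ /=; rewrite mderivM substD !substM mulrDl.
  by congr (_ + _); rewrite -!mulrA; [rewrite [_ * subst f q]mulrC|].
Qed.

Definition line F v w : {poly K} :=
  mmap (@polyC K) (fun i => (v 0 i)%:P + (w 0 i) *: 'X) F.

Lemma lineD F G v w : line (F + G) v w = line F v w + line G v w.
Proof. exact: mmapD. Qed.

Lemma line0 v w : line 0 v w = 0.
Proof. exact: mmap0. Qed.

Lemma lineM F G v w : line (F * G) v w = line F v w * line G v w.
Proof. exact: (mmap_is_multiplicative _ _).1. Qed.

Lemma lineC c v w : line c%:MP v w = c%:P.
Proof. exact: mmapC. Qed.

Lemma lineX i v w : line 'X_i v w = (v 0 i)%:P + (w 0 i) *: 'X.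
Proof. by rewrite /line mmapX mmap1U. Qed.

Lemma horner_line F v w t : (line F v w).[t] = eval F (v + t *: w).
Proof.
elim/mpoly_gen_ind: F => [c|i|p q Ep Eq|p q Ep Eq].
- by rewrite lineC hornerC evalC.
- by rewrite lineX evalX !mxE hornerD hornerC hornerZ hornerX mulrC.
- by rewrite lineD evalD hornerD; congr (_ + _); [exact: Ep | exact: Eq].
- by rewrite lineM evalM hornerM; congr (_ * _); [exact: Ep | exact: Eq].
Qed.

Lemma deriv_line F v w :
  (line F v w)^`() = \sum_i (w 0 i) *: line F^`M(i) v w.
Proof.
elim/mpoly_gen_ind: F => [c|j|p q Ep Eq|p q Ep Eq].
- rewrite lineC derivC big1 // => i _.
  by rewrite mderivC line0 scaler0.
- rewrite lineX derivD derivC derivZ derivX add0r.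
  rewrite (bigD1 j) //= mderivXU eqxx lineC big1 ?addr0 // => i ne.
  by rewrite mderivXU (negbTE ne) lineC scaler0.
- rewrite lineD derivD Ep Eq -big_split; apply: eq_bigr => i _.
  by rewrite mderivD lineD scalerDr.
- rewrite lineM derivM Ep Eq mulr_suml mulr_sumr -big_split.
  apply: eq_bigr => i _ /=; rewrite mderivM lineD !lineM scalerDr.
  by rewrite -scalerAl -scalerAr.
Qed.

Lemma evalN F v : eval (- F) v = - eval F v.
Proof. exact: mevalN. Qed.

Definition grad F v : 'rV[K]_3 := \row_i eval F^`M(i) v.

Lemma grad_homog d F t v :
  F \is d.+1.-homog -> grad F (t *: v) = t ^+ d *: grad F v.
Proof.
move=> hF; apply/rowP => i; rewrite !mxE.
exact: (eval_homog _ _ (mderiv_homog i hF)).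
Qed.

Lemma euler_eval d F v : F \is d.-homog ->
  \sum_i v 0 i * grad F v 0 i = d%:R * eval F v.
Proof.
move/euler/(congr1 (fun G => eval G v)); rewrite eval_sum evalZ => <-.
by apply: eq_bigr => i _; rewrite evalM evalX mxE.
Qed.

End Derivatives.

Local Notation o0 := (@Ordinal 3 0 isT).
Local Notation o1 := (@Ordinal 3 1 isT).
Local Notation o2 := (@Ordinal 3 2 isT).

Lemma ord3P (i : 'I_3) : [\/ i = o0, i = o1 | i = o2].
Proof.
by case: i => -[|[|[|//]]] lt; [apply: Or31 | apply: Or32 | apply: Or33];
  apply: val_inj.
Qed.

Lemma sum_ord3 (V : nmodType) (E : 'I_3 -> V) :
  \sum_i E i = E o0 + E o1 + E o2.
Proof.
rewrite !big_ord_recl big_ord0 addr0 addrA.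
by congr (E _ + E _ + E _); apply: val_inj.
Qed.

Lemma homog_msize (K : fieldType) d (F : {mpoly K[3]}) :
  F != 0 -> F \is d.-homog -> msize F = d.+1.
Proof.
by move=> F0 /dhomogP/(_ _ (mlead_supp F0)) /= dE; rewrite -mlead_deg // dE.
Qed.

Lemma eval_homog0 (K : fieldType) d (F : {mpoly K[3]}) :
  F \is d.+1.-homog -> eval F 0 = 0.
Proof.
by move=> hF; rewrite -[0](scale0r 0) (eval_homog _ _ hF) expr0n mul0r.
Qed.

Section Forms.
Variable K : closedFieldType.
Implicit Types (F G H : {mpoly K[3]}) (v w : 'rV[K]_3).

Lemma eval_ext F G : (forall v, eval F v = eval G v) -> F = G.
Proof.
move=> E; apply: mpoly_ext => v; have := E (\row_i v i).
by rewrite /eval !(@meval_eq _ _ (fun i => (\row_i v i) 0 i) v) // => i;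
  rewrite mxE.
Qed.

(** Inclusion of affine cones, the zero vector included; for irreducible [F] it amounts to
    divisibility of [G] by [F]. *)
Definition vz F G := forall v, eval F v = 0 -> eval G v = 0.

Section Irreducible.
Variables (d : nat) (F : {mpoly K[3]}).
Hypothesis irrF : irreducible_form d.+1 F.

Let hF : F \is d.+1.-homog. Proof. by case: irrF. Qed.
Let F0 : F != 0. Proof. by case: irrF. Qed.

Lemma irreducible_form_elt : irreducible_elt F.
Proof. by case: irrF. Qed.

Lemma vz_divides G : vz F G -> exists H, G = F * H.
Proof.
move=> FG; apply: (hypersurface_nullstellensatz irreducible_form_elt) => v Fv.
have E H : eval H (\row_i v i) = H.@[v].
  by apply: meval_eq => i; rewrite mxE.
by rewrite -E; apply: FG; rewrite E.
Qed.

Lemma divides_vz G H : G = F * H -> vz F G.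
Proof. by move=> -> v Fv; rewrite evalM Fv mul0r. Qed.

Lemma vz_prime G H : vz F (G * H) -> vz F G \/ vz F H.
Proof.
case/vz_divides => M E.
have [_ P] := irreducible_prime_mpoly irreducible_form_elt.
case: (P G H) => [|[M' E']|[M' E']]; first by exists M.
  by left; apply: divides_vz E'.
by right; apply: divides_vz E'.
Qed.

Lemma vz_small e G : G \is e.-homog -> (e <= d)%N -> vz F G -> G = 0.
Proof.
move=> hG ed /vz_divides[H GE]; apply/eqP/negPn/negP => G0.
have H0 : H != 0 by apply: contra_neq G0 => H0; rewrite GE H0 mulr0.
have := homog_msize G0 hG; rewrite GE msizeM // (homog_msize F0 hF).
have : msize H != 0%N by rewrite msize_poly_eq0.
by move: (msize H) => k; lia.
Qed.

Lemma vz_same G : G \is d.+1.-homog -> vz F G -> exists c, G = c *: F.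
Proof.
move=> hG /vz_divides[H GE]; have [G0|G0] := eqVneq G 0.
  by exists 0; rewrite scale0r.
have H0 : H != 0 by apply: contra_neq G0 => H0; rewrite GE H0 mulr0.
have sH : (msize H <= 1)%N.
  have := homog_msize G0 hG; rewrite GE msizeM // (homog_msize F0 hF).
  by move: (msize H) => k; lia.
by exists H@_0%MM; rewrite GE {1}(msize1_polyC sH) mulrC mul_mpolyC.
Qed.

Lemma vzX (i : 'I_3) : (0 < d)%N -> ~ vz F 'X_i.
Proof.
move=> d0 /(@vz_small 1) E; have : ('X_i : {mpoly K[3]}) = 0.
  by apply: E => //; rewrite dhomogX /= mdeg1.
move/(congr1 (fun p => p@_U_(i)%MM)); rewrite mcoeffXU eqxx mcoeff0.
by move/eqP; rewrite oner_eq0.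
Qed.

End Irreducible.

(** Unless the restriction to [v + t w] is a nonzero constant [c], it has a root. In that case the
    zero lies at infinity: by homogeneity the restriction to [w + s v] is [c s ^ (d + 1)], which
    vanishes at [s = 0]. *)
Lemma line_zero F d v w : F \is d.+1.-homog ->
  exists a b, (a != 0) || (b != 0) /\ eval F (a *: v + b *: w) = 0.
Proof.
move=> hF; have [s1|s1] := eqVneq (size (line F v w)) 1%N; last first.
  have /closed_rootP[t /eqP] := s1; rewrite horner_line => Ft.
  by exists 1, t; rewrite oner_eq0 scale1r.
have /size1_polyC cE : (size (line F v w) <= 1)%N by rewrite s1.
set c := _`_0 in cE.
(* The factor ['X] discards [s = 0], where [s] cannot be inverted; it is cancelled afterwards. *)
have E : 'X * (line F w v - c *: 'X^(d.+1)) = 0.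
  apply/eqP/negPn/negP => /closed_nonrootP[s /negP]; apply; apply/eqP.
  rewrite hornerM hornerX; have [->|s0] := eqVneq s 0; first by rewrite mul0r.
  have : (line F v w).[s^-1] = c by rewrite cE hornerC.
  rewrite horner_line => Fc.
  have -> : (line F w v - c *: 'X^(d.+1)).[s] =
     eval F (w + s *: v) - c * s ^+ d.+1.
    by rewrite hornerD hornerN hornerZ hornerXn horner_line.
  have -> : w + s *: v = s *: (v + s^-1 *: w).
    by rewrite scalerDr scalerA mulfV // scale1r addrC.
  by rewrite (eval_homog _ _ hF) Fc (mulrC c) subrr mulr0.
have {}E : line F w v = c *: 'X^(d.+1).
  by apply/eqP; rewrite -subr_eq0; move/eqP: E; rewrite mulf_eq0 polyX_eq0.
exists 0, 1; rewrite oner_eq0 orbT; split=> //; rewrite scale0r add0r scale1r.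
have := congr1 (fun p => p.[0]) E.
by rewrite /= horner_line scale0r addr0 hornerZ hornerXn expr0n mulr0.
Qed.

Lemma linear_irreducible G : G != 0 -> G \is 1.-homog -> irreducible_form 1 G.
Proof.
move=> G0 hG; have sG := homog_msize G0 hG.
split=> //; first by rewrite mpoly_unit_msize sG.
move=> a b E; rewrite !mpoly_unit_msize; move: G0 sG.
rewrite E mulf_eq0 negb_or => /andP[a0 b0]; rewrite msizeM //.
have : msize a != 0%N by rewrite msize_poly_eq0.
have : msize b != 0%N by rewrite msize_poly_eq0.
move: (msize a) (msize b) => k l l0 k0 E'.
have [] : k = 1%N \/ l = 1%N by lia.
  by move=> ->; left.
by move=> ->; right.
Qed.

Lemma linear_homog (c : 'I_3 -> K) : \sum_i c i *: 'X_i \is 1.-homog.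
Proof.
by apply: rpred_sum => i _; apply: rpredZ; rewrite dhomogX /= mdeg1.
Qed.

Lemma linear_coef (c : 'I_3 -> K) (i : 'I_3) :
  (\sum_j c j *: 'X_j : {mpoly K[3]})@_U_(i)%MM = c i.
Proof.
rewrite raddf_sum (bigD1 i) //= mcoeffZ mcoeffXU eqxx mulr1.
rewrite big1 ?addr0 // => j ne.
by rewrite mcoeffZ mcoeffXU (negbTE ne) mulr0.
Qed.

Lemma line_sum (I : Type) (r : seq I) (E : I -> {mpoly K[3]}) v w :
  line (\sum_(i <- r) E i) v w = \sum_(i <- r) line (E i) v w.
Proof.
exact: (big_morph _ (fun F G => lineD F G v w) (line0 v w)).
Qed.

Lemma lineZ c F v w : line (c *: F) v w = c *: line F v w.
Proof. by rewrite -mul_mpolyC lineM lineC mul_polyC. Qed.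

Hypothesis charK0 : [pchar K] =i pred0.

Lemma natK_neq0 n : (n.+1%:R : K) != 0.
Proof. by rewrite ((pcharf0P K).1 charK0). Qed.

Lemma deriv_eq0 (p : {poly K}) : p^`() = 0 -> p = (p`_0)%:P.
Proof.
move=> E; apply: size1_polyC; apply/leq_sizeP => -[//|j] _.
have := congr1 (fun q : {poly K} => q`_j) E; rewrite coef_deriv coef0.
by move/eqP; rewrite -mulr_natr mulf_eq0 (negbTE (natK_neq0 _)) orbF => /eqP.
Qed.

Lemma line_const F v (c : 'rV[K]_3) t : \sum_i c 0 i *: F^`M(i) = 0 ->
  eval F (v + t *: c) = eval F v.
Proof.
move=> E; have : (line F v c)^`() = 0.
  rewrite deriv_line; under eq_bigr do rewrite -lineZ.
  by rewrite -line_sum E line0.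
move/deriv_eq0 => lE.
have E0 s : eval F (v + s *: c) = (line F v c)`_0.
  by rewrite -horner_line {1}lE hornerC.
by rewrite E0 -(E0 0) scale0r addr0.
Qed.

(* If [F] is invariant under the translations by [c], it vanishes on the plane
   spanned by [c] and one of its zeros, hence is divisible by a linear form. *)
Lemma nondegenerate F d (c : 'rV[K]_3) : irreducible_form d.+2 F -> c != 0 ->
  \sum_i c 0 i *: F^`M(i) != 0.
Proof.
move=> irrF c0; apply/eqP => E; have [hF F0 _ Hirr] := irrF.
have [i ci] := row_neq0 c0.
have [j [k [ij ik jk cov]]] : exists j k, [/\ i != j, i != k, j != k &
    forall l, [\/ l = i, l = j | l = k]].
  by case: (ord3P i) => ->; [exists o1, o2 | exists o0, o2 | exists o0, o1];
     split=> // l; case: (ord3P l) => ->;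
     do ?[by apply: Or31 | by apply: Or32 | by apply: Or33].
have [a [b [ab Fab]]] := line_zero (delta_mx 0 j) (delta_mx 0 k) hF.
(* Coefficients of the plane spanned by [c] and [a e_j + b e_k]: their cross product up to sign. *)
pose l (n : 'I_3) : K := if n == i then a * c 0 k - b * c 0 j
  else if n == j then b * c 0 i else - a * c 0 i.
pose L : {mpoly K[3]} := \sum_n l n *: 'X_n.
have L0 : L != 0.
  case/orP: ab => [a0|b0].
  - apply/eqP => /(congr1 (fun p => p@_U_(k)%MM)).
    rewrite linear_coef mcoeff0 /l (eq_sym k) (negbTE ik).
    rewrite (eq_sym k) (negbTE jk).
    by move/eqP; rewrite mulf_eq0 oppr_eq0 (negbTE a0) (negbTE ci).
  - apply/eqP => /(congr1 (fun p => p@_U_(j)%MM)).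
    rewrite linear_coef mcoeff0 /l (eq_sym j) (negbTE ij) eqxx.
    by move/eqP; rewrite mulf_eq0 (negbTE b0) (negbTE ci).
have irrL := linear_irreducible L0 (linear_homog l).
have LF : vz L F.
  move=> v; rewrite eval_sum.
  have -> : \sum_n eval (l n *: 'X_n) v =
      b * (c 0 i * v 0 j - c 0 j * v 0 i) - a * (c 0 i * v 0 k - c 0 k * v 0 i).
    under eq_bigr do rewrite evalZ evalX.
    rewrite (bigD1 i) // (bigD1 j) 1?eq_sym //= (bigD1 k) /=; last first.
      by rewrite !(eq_sym k) ik jk.
    rewrite big1 ?addr0 => [|n /andP[/andP[ni nj] nk]]; last first.
      by case: (cov n) => E'; rewrite E' eqxx in ni nj nk.
    rewrite /l eqxx !(eq_sym _ i) (negbTE ij) (negbTE ik) !eqxx (eq_sym k).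
    by rewrite (negbTE jk); ring.
  (* Projection along [c] onto the plane of vectors with zero coordinate [i]; [F] takes the same
     value at [v] and [v']. *)
  have [v' v'E] : exists v', v' = v + (- (v 0 i / c 0 i)) *: c by eexists.
  have v'i : v' 0 i = 0 by rewrite v'E !mxE mulNr mulfVK ?subrr.
  have -> : b * (c 0 i * v 0 j - c 0 j * v 0 i)
     - a * (c 0 i * v 0 k - c 0 k * v 0 i) =
     c 0 i * (b * v' 0 j - a * v' 0 k).
    by rewrite v'E !mxE; field.
  move/eqP; rewrite mulf_eq0 (negbTE ci) /= subr_eq0 => /eqP ba.
  rewrite -(line_const v (- (v 0 i / c 0 i)) E) -v'E.
  have kj : (k == j) = false by rewrite eq_sym (negbTE jk).
  have [m ->] : exists m, v' = m *: (a *: delta_mx 0 j + b *: delta_mx 0 k).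
    case/orP: ab => [a0|b0]; [exists (v' 0 j / a) | exists (v' 0 k / b)];
      apply/rowP => n; case: (cov n) => ->; rewrite !mxE eqxx
        ?(negbTE ij) ?(negbTE ik) ?(negbTE jk) ?kj ?eqxx ?v'i /=
        ?mulr0 ?mulr1 ?addr0 ?add0r ?mulr0 ?mulfVK //.
      by apply: (mulfI a0); rewrite -ba mulrA [a * _]mulrC mulfVK // mulrC.
    by apply: (mulfI b0); rewrite ba mulrA [b * _]mulrC mulfVK // mulrC.
  by rewrite (eval_homog _ _ hF) Fab mulr0.
have [M FE] := vz_divides irrL LF.
have sF := homog_msize F0 hF.
case: (Hirr _ _ FE) => [UL|UM]; first by case: irrL => _ _ /negP[].
move: sF UM; rewrite mpoly_unit_msize => + /eqP sM.
have M0 : M != 0 by apply: contra_neq F0 => M0; rewrite FE M0 mulr0.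
by rewrite FE msizeM // sM (homog_msize L0 (linear_homog l)).
Qed.

(** Setting [x_1 = 1] leaves a univariate polynomial, which splits, each root [z] giving the factor
    [x_0 - z x_1]. The extra factor [x_1], coded [(0, 1)], covers the zeros with [x_1 = 0]. *)
Lemma binary_split F d : F != 0 -> F \is d.-homog ->
  (forall v w, v 0 o0 = w 0 o0 -> v 0 o1 = w 0 o1 -> eval F v = eval F w) ->
  exists s : seq (K * K), all (fun c => (c.1 != 0) || (c.2 != 0)) s /\
    forall v, eval F v = 0 ->
      \prod_(c <- s) (c.1 * v 0 o0 + c.2 * v 0 o1) = 0.
Proof.
move=> F0 hF ind.
pose P := line F (delta_mx 0 o1) (delta_mx 0 o0).
have FP v : v 0 o1 != 0 -> eval F v = v 0 o1 ^+ d * P.[v 0 o0 / v 0 o1].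
  move=> v1; rewrite horner_line -(eval_homog _ _ hF); apply: ind.
    by rewrite !mxE /= mulr1 add0r mulrC mulfVK.
  by rewrite !mxE /= mulr0 addr0 mulr1.
have P0 : P != 0.
  apply/eqP => P0.
  have : 'X_o1 * F = 0.
    apply: eval_ext => v; rewrite evalM evalX eval0.
    have [->|v1] := eqVneq (v 0 o1) 0; first by rewrite mul0r.
    by rewrite FP // P0 horner0 !mulr0.
  move/eqP; rewrite mulf_eq0 (negbTE F0) orbF => /eqP.
  move/(congr1 (fun p => p@_U_(o1)%MM)); rewrite mcoeffXU eqxx mcoeff0.
  by move/eqP; rewrite oner_eq0.
have [r PE] := closed_field_poly_normal P.
exists ((0, 1) :: [seq (1, - z) | z <- r]); split.
  rewrite /= oner_eq0 orbT /=; apply/allP => _ /mapP[z _ ->] /=.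
  by rewrite oner_eq0.
move=> v; rewrite big_cons /= mul0r add0r mul1r.
have [->|v1] := eqVneq (v 0 o1) 0; first by rewrite mul0r.
rewrite FP // => /eqP; rewrite mulf_eq0 expf_eq0 (negbTE v1) andbF /=.
rewrite PE hornerZ mulf_eq0 lead_coef_eq0 (negbTE P0) /=.
rewrite horner_prod.
rewrite prodf_seq_eq0 => /hasP[z zr /=].
rewrite hornerXsubC subr_eq0 => /eqP vz.
apply/eqP; rewrite mulf_eq0; apply/orP; right.
rewrite prodf_seq_eq0; apply/hasP; exists (1, - z); first exact: map_f.
by rewrite /= -vz mul1r mulNr mulfVK ?subrr.
Qed.

End Forms.

(** * A derivation along the curve *)

Section TangentField.
Variable K : fieldType.
Implicit Types (F G H : {mpoly K[3]}) (v w : 'rV[K]_3).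

(* A vector field tangent to the cone [F = 0]. *)
Definition tder F G : {mpoly K[3]} :=
  F^`M(o1) * G^`M(o2) - F^`M(o2) * G^`M(o1).

Lemma tderM F G H : tder F (G * H) = tder F G * H + G * tder F H.
Proof. by rewrite /tder !mderivM; ring. Qed.

Lemma tderD F G H : tder F (G + H) = tder F G + tder F H.
Proof. by rewrite /tder !mderivD; ring. Qed.

Lemma tderZ F c G : tder F (c *: G) = c *: tder F G.
Proof. by rewrite /tder !mderivZ -!scalerAr scalerBr. Qed.

Lemma tder_self F : tder F F = 0.
Proof. by rewrite /tder mulrC subrr. Qed.

Lemma tder0 F : tder F 0 = 0.
Proof. by rewrite /tder !mderiv0 !mulr0 subrr. Qed.

Lemma tder_sum F (I : Type) (r : seq I) (E : I -> {mpoly K[3]}) :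
  tder F (\sum_(i <- r) E i) = \sum_(i <- r) tder F (E i).
Proof. exact: (big_morph _ (tderD F) (tder0 F)). Qed.

Lemma tder_subst F f H :
  tder F (subst f H) = \sum_i subst f H^`M(i) * tder F (f i).
Proof.
rewrite /tder !mderiv_subst !mulr_sumr -sumrB.
by apply: eq_bigr => i _; rewrite mulrBr !(mulrCA (subst _ _)).
Qed.

Lemma tderXn F i n :
  tder F ('X_i ^+ n.+1) = n.+1%:R *: ('X_i ^+ n * tder F 'X_i).
Proof.
elim: n => [|n IH]; first by rewrite !expr1 mul1r scale1r.
rewrite exprS tderM IH -scalerAr mulrA -exprS [tder F _ * _]mulrC.
by rewrite -[X in X + _]scale1r -scalerDl -mulrS.
Qed.

Lemma tderX F : [/\ tder F 'X_o0 = 0, tder F 'X_o1 = - F^`M(o2)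
  & tder F 'X_o2 = F^`M(o1)].
Proof.
by rewrite /tder !mderivXU /= !mpolyC0 !mpolyC1 !mulr0 !mulr1 !subrr ?sub0r
  ?subr0.
Qed.

(** Differentiate Euler's identity: the terms in which the derivation hits a coordinate cancel,
    being two opposite products of partial derivatives. *)
Lemma tder_euler d F : F \is d.-homog -> \sum_i 'X_i * tder F F^`M(i) = 0.
Proof.
move/euler/(congr1 (tder F)); rewrite tderZ tder_self scaler0 tder_sum => E.
rewrite -[RHS]E; under [RHS]eq_bigr do rewrite tderM.
rewrite big_split /= -[LHS]add0r; congr (_ + _).
have [X0 X1 X2] := tderX F.
by rewrite sum_ord3 X0 X1 X2 mul0r add0r mulNr mulrC addNr.
Qed.

End TangentField.

(** * The Gauss map is not constant along the curve *)

Section Curvature.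
Variable K : closedFieldType.
Hypothesis charK0 : [pchar K] =i pred0.
Implicit Types (F G H : {mpoly K[3]}) (v w : 'rV[K]_3).

Lemma vz_tder F d G : irreducible_form d.+1 F -> vz F G -> vz F (tder F G).
Proof.
move=> irrF /(vz_divides irrF)[H ->]; rewrite tderM tder_self mul0r add0r.
exact: divides_vz.
Qed.

Lemma vz_nondegenerate F d (c : 'rV[K]_3) : irreducible_form d.+2 F -> c != 0 ->
  ~ vz F (\sum_i c 0 i *: F^`M(i)).
Proof.
move=> irrF c0 E; have := nondegenerate charK0 irrF c0.
rewrite (vz_small irrF _ (leqnn _) E) ?eqxx //.
by apply: rpred_sum => i _; apply/rpredZ/mderiv_homog; case: irrF.
Qed.

Lemma vz_partial F d i : irreducible_form d.+2 F -> ~ vz F F^`M(i).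
Proof.
move=> irrF E; apply: (vz_nondegenerate irrF (c := delta_mx 0 i)).
  by apply/eqP => /matrixP/(_ 0 i)/eqP; rewrite !mxE !eqxx oner_eq0.
rewrite (bigD1 i) //= big1 ?addr0 ?mxE ?eqxx ?scale1r // => j ne.
by rewrite mxE (negbTE ne) andbF scale0r.
Qed.

Lemma vz_prod F d (I : Type) (r : seq I) (E : I -> {mpoly K[3]}) :
  irreducible_form d.+1 F -> vz F (\prod_(i <- r) E i) ->
  foldr (fun i P => vz F (E i) \/ P) False r.
Proof.
move=> irrF; elim: r => [|i r IH] /=; last first.
  by rewrite big_cons => /(vz_prime irrF)[]; [left | move/IH; right].
rewrite big_nil => /(_ 0); have [hF _ _ _] := irrF.
rewrite (eval_homog0 hF) => /(_ erefl).
by rewrite -mpolyC1 evalC => /eqP; rewrite oner_eq0.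
Qed.

Definition binary F := forall v w,
  v 0 o0 = w 0 o0 -> v 0 o1 = w 0 o1 -> eval F v = eval F w.

(** A binary form splits into linear factors, and by primality one of them would vanish on the curve
    after substitution. *)
Lemma vz_binary F d f H n : irreducible_form d.+1 F ->
  H != 0 -> H \is n.-homog -> binary H ->
  (forall c : K * K, (c.1 != 0) || (c.2 != 0) ->
     ~ vz F (c.1 *: f o0 + c.2 *: f o1)) ->
  ~ vz F (subst f H).
Proof.
move=> irrF H0 hH binH indf Hf.
have [s [s0 Hs]] := binary_split H0 hH binH.
have {Hs} : vz F (\prod_(c <- s) (c.1 *: f o0 + c.2 *: f o1)).
  move=> v /Hf; rewrite eval_subst => /Hs; rewrite !mxE /= => <-.
  rewrite (big_morph (fun G => eval G v) (fun G G' => evalM G G' v)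
    (evalC 1 v)).
  by apply: eq_bigr => c _; rewrite evalD !evalZ.
move/(vz_prod irrF); elim: s s0 => //= c s IH /andP[c0 /IH{}IH] [|/IH//].
by move/(indf _ c0).
Qed.

Lemma partial_independent F d (c : K * K) : irreducible_form d.+2 F ->
  (c.1 != 0) || (c.2 != 0) ->
  ~ vz F (c.1 *: F^`M(o0) + c.2 *: F^`M(o1)).
Proof.
move=> irrF c0 E; pose u : 'rV[K]_3 := \row_i [:: c.1; c.2; 0]`_i.
apply: (vz_nondegenerate irrF (c := u)); last first.
  by rewrite sum_ord3 !mxE /= scale0r addr0.
apply: contraTneq c0 => u0.
have := congr1 (fun w : 'rV[K]_3 => w 0 o0) u0.
have := congr1 (fun w : 'rV[K]_3 => w 0 o1) u0.
by rewrite !mxE /= => -> ->; rewrite eqxx.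
Qed.

(* If the ratio of two partial derivatives of [F] were constant along the curve,
   then so would be the ratio of any two forms of degree [d + 1]: differentiate
   a relation of minimal degree. *)
Lemma curvature F d : irreducible_form d.+2 F ->
  ~ vz F (F^`M(o1) * tder F F^`M(o0) - F^`M(o0) * tder F F^`M(o1)).
Proof.
move=> irrF; have [hF F0 _ _] := irrF.
set p := F^`M(o0); set q := F^`M(o1) => Epq.
have hp : p \is d.+1.-homog by apply: mderiv_homog.
have hq : q \is d.+1.-homog by apply: mderiv_homog.
have const r : r \is d.+1.-homog -> vz F (q * tder F r - r * tder F q).
  move=> hr; pose f (i : 'I_3) := [:: p; q; r]`_i.
  have hf i : f i \is d.+1.-homog by case: (ord3P i) => ->.
  pose P n := `[< exists H, [/\ H != 0, H \is n.-homog & vz F (subst f H)] >].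
  have exP : exists n, P n.
    have [n [H [H0 hH [M HE]]]] := relation_exists F0 hF isT hf isT.
    by exists n; apply/asboolP; exists H; split=> //; apply: divides_vz HE.
  have [n /asboolP[H [H0 hH Hf]] minP] := ex_minnP exP.
  case: n hH minP => [|n] hH minP.
    move: (msize1_polyC (eq_leq (homog_msize H0 hH))) => HC.
    have := Hf 0; rewrite (eval_homog0 hF) HC /subst comp_mpolyC evalC.
    move=> /(_ erefl) c0.
    by case/eqP: H0; rewrite HC c0 mpolyC0.
  (* In characteristic 0 this means that the minimal relation does not involve [r]: it is binary in
     [p] and [q], which are linearly independent on the curve. *)
  have [H2|H2] := eqVneq H^`M(o2) 0.
    case: (vz_binary irrF H0 hH _ _ Hf) => [v w E0 E1|c c0]; last first.
      exact: partial_independent irrF c0.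
    rewrite -(line_const charK0 w (v 0 o2 - w 0 o2) (c := delta_mx 0 o2)).
      congr eval; apply/rowP => i.
      by case: (ord3P i) => ->; rewrite !mxE /= ?mulr0 ?addr0 ?mulr1 ?subrKC.
    by rewrite sum_ord3 !mxE /= !scale0r !add0r scale1r.
  have nH2 : ~ vz F (subst f H^`M(o2)).
    move=> E; have /minP : P n; last by rewrite ltnn.
    by apply/asboolP; exists H^`M(o2); split=> //; apply: mderiv_homog.
  have [|//] : vz F (subst f H^`M(o2)) \/ vz F (q * tder F r - r * tder F q);
    last by [].
  apply: (vz_prime irrF) => v Fv.
  have E1 := vz_tder irrF Hf Fv.
  rewrite tder_subst sum_ord3 !evalD !evalM /f /= in E1.
  have E2 := Epq v Fv; rewrite evalB !evalM in E2.
  have E3 : eval H^`M(o0) (\row_i eval (f i) v) * eval p v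
    + eval H^`M(o1) (\row_i eval (f i) v) * eval q v
    + eval H^`M(o2) (\row_i eval (f i) v) * eval r v = 0.
    have := euler_eval (\row_i eval (f i) v) hH.
    rewrite -eval_subst (Hf _ Fv) mulr0 sum_ord3 !mxE /f /= => <-.
    by rewrite ![eval _ v * _]mulrC.
  rewrite -!eval_subst in E3.
  rewrite evalM evalB !evalM.
  move: (eval (subst f H^`M(o0)) v) (eval (subst f H^`M(o1)) v)
    (eval (subst f H^`M(o2)) v) (eval p v) (eval q v) (eval r v)
    (eval (tder F p) v) (eval (tder F q) v) (eval (tder F r) v) E1 E2 E3.
  move=> h0 h1 h2 p' q' r' dp dq dr E1 E2 E3.
  (* Elimination of [h0] and [h1] between the differentiated relation, Euler's identity for [H], and
     the assumed equality [q' * dp = p' * dq]. *)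
  have -> : h2 * (q' * dr - r' * dq) = q' * (h0 * dp + h1 * dq + h2 * dr)
    - h0 * (q' * dp - p' * dq) - (h0 * p' + h1 * q' + h2 * r') * dq by ring.
  by rewrite E1 E2 E3 !mulr0 mul0r !subr0.
(* The power ['X_i ^+ d.+1] has the degree of [q], so [const] applies to it; a factor ['X_i ^+ d] is
   then cancelled. *)
have constX i : vz F (d.+1%:R *: q * tder F 'X_i - 'X_i * tder F q).
  have hX : ('X_i : {mpoly K[3]}) ^+ d.+1 \is d.+1.-homog.
    by rewrite -[X in X.-homog]mul1n; apply: dhomogMn; rewrite dhomogX /= mdeg1.
  have := const _ hX; rewrite tderXn.
  have -> : q * (d.+1%:R *: ('X_i ^+ d * tder F 'X_i)) - 'X_i ^+ d.+1 * tder F q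
    = 'X_i ^+ d * (d.+1%:R *: q * tder F 'X_i - 'X_i * tder F q).
    by rewrite exprSr -!mul_mpolyC; ring.
  elim: (d in 'X_i ^+ d) => [|e IH]; first by rewrite expr0 mul1r.
  by rewrite exprS -mulrA => /(vz_prime irrF)[/(vzX irrF isT)|/IH].
(* The derivation kills [x_0], so [constX] first gives [tder F q = 0] on the curve, and then, with
   [x_1], that a product of two partial derivatives vanishes there. *)
have [X0 X1 _] := tderX F.
have dq0 : vz F (tder F q).
  have := constX o0; rewrite X0 mulr0 sub0r -mulrN => /(vz_prime irrF)[].
    by move/(vzX irrF isT).
  by move=> E v /E; rewrite evalN => /eqP; rewrite oppr_eq0 => /eqP.
have : vz F (q * F^`M(o2)).
  move=> v Fv; have := constX o1 v Fv; rewrite X1 evalB !evalM (dq0 _ Fv) mulr0.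
  rewrite subr0 evalN evalZ => /eqP; rewrite mulrN oppr_eq0 -mulrA mulf_eq0.
  by rewrite (negbTE (natK_neq0 charK0 _)) => /eqP.
by case/(vz_prime irrF) => /(vz_partial irrF).
Qed.

End Curvature.

(** * The equation of the dual curve *)

Section DualForm.
Variable K : closedFieldType.
Hypothesis charK0 : [pchar K] =i pred0.
Implicit Types (F G H : {mpoly K[3]}) (v w : 'rV[K]_3).

Lemma poly_ext (p q : {poly K}) : (forall t, p.[t] = q.[t]) -> p = q.
Proof.
move=> E; apply/eqP; rewrite -subr_eq0; apply/negPn/negP.
case/closed_nonrootP => t /negP; apply; apply/eqP.
by rewrite hornerD hornerN E subrr.
Qed.

(** On the line [t w] through the origin the component of degree [k] contributes exactly the term in
    [t ^ k]. *)
Lemma eval_pihomog k H w : eval (pihomog mdeg k H) w = (line H 0 w)`_k.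
Proof.
pose N := maxn (msize H) k.+1.
rewrite {2}(pihomog_partitionE (leq_maxl (msize H) k.+1)) line_sum coef_sum.
have kN : (k < N)%N by rewrite leq_max ltnSn orbT.
have E (j : nat) : line (pihomog mdeg j H) 0 w =
    eval (pihomog mdeg j H) w *: 'X^j.
  apply: poly_ext => t; rewrite horner_line add0r hornerZ hornerXn mulrC.
  exact/eval_homog/pihomogP.
rewrite (bigD1 (Ordinal kN)) //= E coefZ coefXn eqxx mulr1 big1 ?addr0 //.
move=> j ne; rewrite E coefZ coefXn; case: eqP => [kj|]; last by rewrite mulr0.
by case/eqP: ne; apply: val_inj; rewrite /= kj.
Qed.

(* The ideal of the dual curve. *)
Definition kills_dual F H := forall v, eval F v = 0 -> eval H (grad F v) = 0.

Lemma kills_dualE F H :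
  kills_dual F H <-> vz F (subst (fun i => F^`M(i)) H).
Proof. by split=> E v Fv; have := E v Fv; rewrite eval_subst. Qed.

(** The cone of [F] is stable under scaling and every scalar is of the form [t ^ (d + 1)], so [H]
    vanishes on the whole line spanned by a gradient. *)
Lemma kills_dual_pihomog F d k H : irreducible_form d.+2 F ->
  kills_dual F H -> kills_dual F (pihomog mdeg k H).
Proof.
move=> [hF _ _ _] FH v Fv; rewrite eval_pihomog.
suff -> : line H 0 (grad F v) = 0 by rewrite coef0.
apply: poly_ext => s; rewrite horner_line add0r horner0.
have /closed_rootP[t] : size ('X^(d.+1) - s%:P) != 1%N by rewrite size_XnsubC.
rewrite /root hornerD hornerN hornerC hornerXn subr_eq0 => /eqP <-.
by rewrite -(grad_homog _ _ hF); apply: FH; rewrite (eval_homog _ _ hF) Fv mulr0.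
Qed.

(** A nonzero homogeneous component of [B] is still binary and still kills the dual curve; splitting
    it would give a linear relation between two partial derivatives. *)
Lemma kills_dual_binary F d B : irreducible_form d.+2 F -> B != 0 ->
  binary B -> ~ kills_dual F B.
Proof.
move=> irrF B0 binB FB.
have [k Bk] : exists k, pihomog mdeg k B != 0.
  apply: contrapT => nex; case/eqP: B0.
  rewrite (pihomog_partitionE (leqnn (msize B))) big1 // => j _.
  by apply: contrapT => /eqP Bj; apply: nex; exists j.
have hBk : pihomog mdeg k B \is k.-homog := pihomogP _ _ _.
apply: (vz_binary irrF Bk hBk (f := fun i => F^`M(i))) => [v w E0 E1|c c0|].
- rewrite !eval_pihomog; suff -> : line B 0 v = line B 0 w by [].
  apply: poly_ext => t.
  by rewrite !horner_line; apply: binB; rewrite !mxE ?E0 ?E1.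
- exact: (partial_independent charK0 irrF c0).
- exact/kills_dualE/(kills_dual_pihomog _ irrF).
Qed.

Lemma multi_of_uniC (c : {mpoly K[2]}) : multi_of_uni c%:P = mwiden c.
Proof. by rewrite /multi_of_uni map_polyC hornerC. Qed.

Lemma binary_mwiden (c : {mpoly K[2]}) : binary (mwiden c).
Proof.
move=> v w E0 E1; rewrite /eval !meval_muni !muni_mwiden !map_polyC !hornerC /=.
apply: meval_eq => i /=.
have := ltn_ord i; case: i => -[|[|//]] lt _ /=.
  by rewrite (_ : widen_ord _ _ = o0) //; apply: val_inj.
by rewrite (_ : widen_ord _ _ = o1) //; apply: val_inj.
Qed.

Lemma linear_form_coef H : H \is 1.-homog ->
  exists c : 'rV[K]_3, H = \sum_i c 0 i *: 'X_i.
Proof.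
move=> hH; exists (\row_i (H^`M(i))@_0%MM).
have := euler hH; rewrite scale1r => {1}<-; apply: eq_bigr => i _.
rewrite mxE mulrC -mul_mpolyC; congr (_ * _); apply: msize1_polyC.
have [->|Hi] := eqVneq H^`M(i) 0; first by rewrite msize0.
by rewrite (homog_msize Hi (mderiv_homog i hH)).
Qed.

Lemma grad_homog0 F d : F \is d.+2.-homog -> grad F 0 = 0.
Proof.
move=> hF; apply/rowP => i.
by rewrite !mxE (eval_homog0 (mderiv_homog i hF)).
Qed.

Lemma dual_form_exists F d : irreducible_form d.+2 F ->
  exists n F', irreducible_form n.+2 F' /\
    forall H, kills_dual F H <-> vz F' H.
Proof.
move=> irrF; have [hF F0 _ _] := irrF.
pose P n := `[< exists H, [/\ H != 0, H \is n.-homog & kills_dual F H] >].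
have exP : exists n, P n.
  have [n [H [H0 hH [M HE]]]] := relation_exists F0 hF isT
    (fun i => mderiv_homog i hF) isT.
  exists n; apply/asboolP; exists H; split=> //.
  exact/kills_dualE/divides_vz/HE.
have [n /asboolP[F' [F'0 hF' FF']] minP] := ex_minnP exP.
(* Stated for inhomogeneous [H] as well, because it is applied to factors of [F'] that are not known
   to be forms. *)
have minH H : H != 0 -> kills_dual F H -> (n < msize H)%N.
  move=> H0 FH.
  have [[k kH] Bk] : exists k : 'I_(msize H), pihomog mdeg k H != 0.
    apply: contrapT => nex; case/eqP: H0.
    rewrite (pihomog_partitionE (leqnn (msize H))) big1 // => j _.
    by apply: contrapT => /eqP Bj; apply: nex; exists j.
  apply: (leq_ltn_trans _ kH); apply: minP; apply/asboolP.
  exists (pihomog mdeg k H); split=> //; first exact: pihomogP.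
  exact: kills_dual_pihomog irrF FH.
(* A nonzero constant does not vanish, and a linear form would be a linear relation between the
   partial derivatives of [F]. *)
have n1 : (1 < n)%N.
  case: n hF' {minP minH} => [|[|//]] hF'.
    have := FF' 0; rewrite (eval_homog0 hF) => /(_ erefl).
    have F'C := msize1_polyC (eq_leq (homog_msize F'0 hF')).
    rewrite F'C evalC => c0.
    by case/eqP: F'0; rewrite F'C c0 mpolyC0.
  have [c F'E] := linear_form_coef hF'.
  case: (vz_nondegenerate charK0 irrF (c := c)).
    apply: contra_neq F'0 => c0; rewrite F'E c0 big1 // => i _.
    by rewrite mxE scale0r.
  move=> v /FF'; rewrite F'E !eval_sum => E; rewrite -[RHS]E.
  by apply: eq_bigr => i _; rewrite !evalZ evalX mxE.
have sF' := homog_msize F'0 hF'.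
case: n n1 hF' sF' minP minH => [|[|n]] // _ hF' sF' _ minH.
have irrF' : irreducible_form n.+2 F'.
  split=> //; first by rewrite mpoly_unit_msize sF'.
  have unit_of a b : F' = a * b -> kills_dual F a -> b \is a GRing.unit.
    move=> E Fa; move: (F'0); rewrite E mulf_eq0 negb_or => /andP[a0 b0].
    have sa := minH _ a0 Fa; rewrite mpoly_unit_msize.
    have : msize b != 0%N by rewrite msize_poly_eq0.
    move: sF'; rewrite E msizeM //; move: (msize a) (msize b) sa => x y; lia.
  move=> a b E.
  have : vz F (subst (fun i => F^`M(i)) a * subst (fun i => F^`M(i)) b).
    move=> v Fv; rewrite evalM !eval_subst -evalM -E; exact: FF'.
  case/(vz_prime irrF) => /kills_dualE FH.
    by right; apply: unit_of E FH.
  by left; apply: (unit_of b); rewrite // mulrC.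
exists n, F'; split=> // H; split=> [FH|F'H]; last first.
  have [M ->] := vz_divides irrF' F'H.
  by move=> v Fv; rewrite evalM FF' // mul0r.
have irre := irreducible_form_elt irrF'.
(* When the last variable does not occur in [F'], this form is itself binary. *)
have [sf|sf] := leqP (size (muni F')) 1.
  case: (kills_dual_binary irrF F'0 _ FF').
  have := muniK F'; rewrite (size1_polyC sf) multi_of_uniC => <-.
  exact: binary_mwiden.
(* In the coprime case [c] is a combination of [F'] and [H], so it kills the dual curve although it
   is binary. *)
have [|[c c0 [a [b E]]]] := irreducible_divides_or_coprime
  (prime_product_mpoly (@irreducible_prime_mpoly K 2)) (muni H)
  (irreducible_muni irre) sf.
  by move/divides_muni => [M ->]; apply: divides_vz.
case: (kills_dual_binary irrF _ (@binary_mwiden c)).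
  by apply: contra_neq c0 => c0; apply: (@inj_mwiden 2 K); rewrite c0 mwiden0.
have Ec : mwiden c = multi_of_uni a * F' + multi_of_uni b * H.
  rewrite -multi_of_uniC; apply: (etrans _ (multi_of_uni_lincomb a b F' H)).
  exact: (congr1 (@multi_of_uni 2 K) E).
have lin (x y p q : K) : p = 0 -> q = 0 -> x * p + y * q = 0.
  by move=> -> ->; rewrite !mulr0 addr0.
move=> v Fv; rewrite Ec evalD !evalM.
exact: (lin _ _ _ _ (FF' _ Fv) (FH _ Fv)).
Qed.

End DualForm.

(** * Biduality *)

Section Parallel.
Variable K : fieldType.
Implicit Types v w : 'rV[K]_3.

Definition parallel v w := forall i j, v 0 i * w 0 j = v 0 j * w 0 i.

Lemma parallel_scale v w : v != 0 -> parallel v w -> exists a, w = a *: v.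
Proof.
move=> v0 vw; have [i vi] := row_neq0 v0.
exists (w 0 i / v 0 i); apply/rowP => j; rewrite mxE.
by apply: (mulfI vi); rewrite vw; field.
Qed.

(** The nonzero minor allows Cramer's rule, which expresses [u] and [v] by their last coordinates
    through the same formulas. *)
Lemma orthogonal_parallel (u v w y : 'rV[K]_3) :
  \sum_i w 0 i * u 0 i = 0 -> \sum_i y 0 i * u 0 i = 0 ->
  \sum_i w 0 i * v 0 i = 0 -> \sum_i y 0 i * v 0 i = 0 ->
  w 0 o1 * y 0 o0 - w 0 o0 * y 0 o1 != 0 -> parallel v u.
Proof.
rewrite !sum_ord3 => wu yu wv yv nz.
have cramer (w0 w1 w2 y0 y1 y2 a0 a1 a2 : K) :
    w0 * a0 + w1 * a1 + w2 * a2 = 0 -> y0 * a0 + y1 * a1 + y2 * a2 = 0 ->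
    w1 * y0 - w0 * y1 != 0 ->
    a0 = (w2 * y1 - w1 * y2) * a2 / (w1 * y0 - w0 * y1) /\
    a1 = (w0 * y2 - w2 * y0) * a2 / (w1 * y0 - w0 * y1).
  move=> wa ya n0; split; apply: (mulIf n0); rewrite mulfVK //;
    apply/eqP; rewrite -subr_eq0; apply/eqP.
    rewrite [LHS](_ : _ = w1 * (y0 * a0 + y1 * a1 + y2 * a2)
      - y1 * (w0 * a0 + w1 * a1 + w2 * a2)); last by ring.
    by rewrite wa ya !mulr0 subrr.
  rewrite [LHS](_ : _ = y0 * (w0 * a0 + w1 * a1 + w2 * a2)
    - w0 * (y0 * a0 + y1 * a1 + y2 * a2)); last by ring.
  by rewrite wa ya !mulr0 subrr.
have [ua0 ua1] := cramer _ _ _ _ _ _ _ _ _ wu yu nz.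
have [va0 va1] := cramer _ _ _ _ _ _ _ _ _ wv yv nz.
by move=> i j; case: (ord3P i) => ->; case: (ord3P j) => ->;
  rewrite ?ua0 ?ua1 ?va0 ?va1 //; field.
Qed.

End Parallel.

Section Biduality.
Variable K : closedFieldType.
Hypothesis charK0 : [pchar K] =i pred0.
Implicit Types (F G H : {mpoly K[3]}) (v w : 'rV[K]_3).

Definition bidual F F' v := grad F' (grad F v).

Lemma bidual_parallel F F' d n : irreducible_form d.+2 F ->
  F' \is n.-homog -> kills_dual F F' ->
  forall v, eval F v = 0 -> parallel v (bidual F F' v).
Proof.
move=> irrF hF' FF' v Fv i j; have [hF _ _ _] := irrF.
pose f i := F^`M(i).
pose M := 'X_i * subst f F'^`M(j) - 'X_j * subst f F'^`M(i).
have gE k v' : eval (subst f F'^`M(k)) v' = bidual F F' v' 0 k.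
  by rewrite eval_subst mxE.
suff : eval M v = 0.
  by rewrite evalB !evalM !evalX !gE => /eqP; rewrite subr_eq0 => /eqP.
(* The minor required by [orthogonal_parallel] is the form of [curvature]; multiplying by it leaves
   only the points where it is nonzero. *)
have : vz F ((F^`M(o1) * tder F F^`M(o0) - F^`M(o0) * tder F F^`M(o1)) * M);
  last by case/(vz_prime irrF) => [/(curvature charK0 irrF)|/(_ _ Fv)].
move=> {Fv}v Fv; rewrite evalM.
have [->|nz] := eqVneq (eval (F^`M(o1) * tder F F^`M(o0)
  - F^`M(o0) * tder F F^`M(o1)) v) 0.
  by rewrite mul0r.
apply/eqP; rewrite mulf_eq0; apply/orP; right; apply/eqP.
rewrite evalB !evalM !evalX !gE; apply/eqP; rewrite subr_eq0; apply/eqP.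
pose y : 'rV[K]_3 := \row_k eval (tder F F^`M(k)) v.
apply: (@orthogonal_parallel _ _ _ (grad F v) y).
- rewrite (euler_eval _ hF'); have := FF' _ Fv; rewrite /kills_dual => ->.
  by rewrite mulr0.
- have := vz_tder irrF ((kills_dualE _ _).1 FF') Fv; rewrite tder_subst eval_sum.
  by move=> E; rewrite -[RHS]E; apply: eq_bigr => k _; rewrite evalM gE mxE mulrC.
- have := euler_eval v hF; rewrite Fv mulr0 => E; rewrite -[RHS]E.
  by apply: eq_bigr => k _; rewrite mulrC.
- have := congr1 (fun G => eval G v) (tder_euler hF).
  rewrite /= eval_sum eval0 => E; rewrite -[RHS]E.
  by apply: eq_bigr => k _; rewrite evalM evalX mxE mulrC.
- by move: nz; rewrite evalB !evalM !mxE.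
Qed.

(** Symmetric in [F] and [F'], so that every consequence applies in both directions. The last
    clauses ensure that the bidual maps are not identically zero, that is, generically a nonzero
    multiple of the identity. *)
Definition dual_pair F F' := exists d n,
  [/\ irreducible_form d.+3 F, irreducible_form n.+3 F',
      (kills_dual F F' /\ kills_dual F' F),
      (forall v, eval F v = 0 -> parallel v (bidual F F' v)) /\
      (forall w, eval F' w = 0 -> parallel w (bidual F' F w)) &
      (exists2 v, eval F v = 0 & bidual F F' v != 0) /\
      (exists2 w, eval F' w = 0 & bidual F' F w != 0)].

Lemma dual_pair_sym F F' : dual_pair F F' -> dual_pair F' F.
Proof. by move=> [d [n [? ? [? ?] [? ?] [? ?]]]]; exists n, d; split. Qed.

(** The gradient of a quadric is a linear map [M]. Biduality makes [grad F v] proportional to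
    [v *m invmx M], and Euler's identity puts the curve on the quadric [Q]. As [F] has degree at
    least 3, [Q = 0]; but [Q] at [grad F' w] is [2 F'(w)]. *)
Lemma quadric_dual F F' d : irreducible_form d.+3 F ->
  irreducible_form 2 F' -> kills_dual F F' ->
  (forall v, eval F v = 0 -> parallel v (bidual F F' v)) -> False.
Proof.
move=> irrF irrF' FF' par; have [hF F0 _ _] := irrF; have [hF' F'0 _ _] := irrF'.
pose M : 'M[K]_3 := \matrix_(i, j) (F'^`M(j)^`M(i))@_0%MM.
have gM w : grad F' w = w *m M.
  apply/rowP => j; rewrite !mxE.
  have := euler_eval w (mderiv_homog j hF'); rewrite mul1r => <-.
  apply: eq_bigr => i _; rewrite !mxE; congr (_ * _).
  have hij : F'^`M(j)^`M(i) \is 0.-homog by do 2 apply: mderiv_homog.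
  rewrite [X in eval X w](_ : _ = ((F'^`M(j)^`M(i))@_0%MM)%:MP) ?evalC //.
  apply: msize1_polyC.
  have [->|nz] := eqVneq F'^`M(j)^`M(i) 0; first by rewrite msize0.
  by rewrite (homog_msize nz hij).
have uM : M \in unitmx.
  rewrite -unitmx_tr unitmxE unitfE; apply/negP => /det0P[c c0 cM].
  have := nondegenerate charK0 irrF' c0; move/negP; apply; apply/eqP.
  apply: eval_ext => w; rewrite eval0 eval_sum.
  have -> : \sum_i eval (c 0 i *: F'^`M(i)) w = (c *m (grad F' w)^T) 0 0.
    by rewrite mxE; apply: eq_bigr => i _; rewrite evalZ !mxE.
  by rewrite gM trmx_mul mulmxA cM mul0mx mxE.
pose h := invmx M.
pose Q : {mpoly K[3]} := \sum_i 'X_i * (\sum_j h j i *: 'X_j).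
have QE v : eval Q v = \sum_i v 0 i * (v *m h) 0 i.
  rewrite eval_sum; apply: eq_bigr => i _; rewrite evalM evalX eval_sum mxE.
  by congr (_ * _); apply: eq_bigr => j _; rewrite evalZ evalX mulrC.
have hQ : Q \is 2.-homog.
  apply: rpred_sum => i _; apply: (@dhomogM _ _ _ 1 _ 1).
    by rewrite dhomogX /= mdeg1.
  by apply: rpred_sum => j _; apply: rpredZ; rewrite dhomogX /= mdeg1.
have FQ : vz F Q.
  (* The added factor restricts the work to points with nonzero gradient, where the proportionality
     factor [a] is nonzero. *)
  have : vz F (F^`M(o0) * Q);
    last by case/(vz_prime irrF) => // /(vz_partial charK0 irrF).
  move=> v Fv; rewrite evalM.
  have [->|w0] := eqVneq (eval F^`M(o0) v) 0; first by rewrite mul0r.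
  rewrite QE.
  have [->|v0] := eqVneq v 0.
    by rewrite big1 ?mulr0 // => i _; rewrite mxE mul0r.
  have [a ua] := parallel_scale v0 (par v Fv).
  have wE : grad F v = a *: (v *m h).
    by rewrite -[LHS]mulmx1 -(mulmxV uM) mulmxA -gM -/(bidual _ _ _) ua -scalemxAl.
  have a0 : a != 0.
    apply: contra_neq w0 => a0; have := congr1 (fun w : 'rV[K]_3 => w 0 o0) wE.
    by rewrite a0 scale0r !mxE.
  apply/eqP; rewrite mulf_eq0 (negbTE w0) /=; apply/eqP.
  apply: (mulfI a0); rewrite mulr0 mulr_sumr.
  have := euler_eval v hF; rewrite Fv mulr0 wE => E; rewrite -[RHS]E.
  by apply: eq_bigr => i _; rewrite [in RHS]mxE mulrCA.
have Q0 := vz_small irrF hQ isT FQ.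
case/eqP: F'0; apply: eval_ext => w; rewrite eval0.
have := QE (grad F' w); rewrite Q0 eval0 {2}gM -mulmxA (mulmxV uM) mulmx1.
have := euler_eval w hF'; rewrite (eq_bigr _ (fun i _ => mulrC _ _)) => -> /esym/eqP.
by rewrite mulf_eq0 (negbTE (natK_neq0 charK0 _)) => /eqP.
Qed.

(** Polynomials killing the dual curve are the multiples of [F'], so an identity checked at the
    vectors [grad F v] holds at all zeros of [F']. This transfers biduality from [F] to [F']. *)
Lemma dual_pair_exists F d : irreducible_form d.+3 F ->
  exists F', dual_pair F F'.
Proof.
move=> irrF; have [hF _ _ _] := irrF.
have [n [F' [irrF' FF'E]]] := dual_form_exists charK0 irrF.
have FF' : kills_dual F F' by apply/FF'E.
have [hF' _ _ _] := irrF'.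
have par := bidual_parallel irrF hF' FF'.
case: n irrF' hF' => [|n] irrF' hF'.
  by case: (quadric_dual irrF irrF' FF' par).
(* Otherwise a partial derivative of [F'] would kill the dual curve and hence be a multiple of
   [F']. *)
have [v1 Fv1 u1] : exists2 v, eval F v = 0 & bidual F F' v != 0.
  apply: contrapT => nex; apply: (@vz_partial _ charK0 _ _ o0 irrF').
  apply/FF'E => v Fv; apply: contrapT => nz; apply: nex; exists v => //.
  by apply: contra_not_neq nz => /rowP/(_ o0); rewrite !mxE.
have scale v : eval F v = 0 -> exists a, bidual F F' v = a *: v.
  move=> Fv; have [->|v0] := eqVneq v 0; last exact: parallel_scale v0 (par v Fv).
  by exists 0; rewrite /bidual (grad_homog0 hF) (grad_homog0 hF') scale0r.
have F'F : kills_dual F' F.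
  apply/kills_dualE/FF'E => v Fv; rewrite eval_subst -/(grad _ _) -/(bidual _ _ _).
  by have [a ->] := scale v Fv; rewrite (eval_homog _ _ hF) Fv mulr0.
have bid v : eval F v = 0 -> exists a, bidual F' F (grad F v) = a *: grad F v.
  move=> Fv; rewrite /bidual -/(bidual F F' v); have [a ->] := scale v Fv.
  by exists (a ^+ d.+2); rewrite (grad_homog _ _ hF).
exists F', d, n; split=> //.
- split=> // w F'w i j.
  pose f i := F'^`M(i).
  pose M := 'X_i * subst f F^`M(j) - 'X_j * subst f F^`M(i).
  have gE k w' : eval (subst f F^`M(k)) w' = bidual F' F w' 0 k.
    by rewrite eval_subst mxE.
  have ME w' :
      eval M w' = w' 0 i * bidual F' F w' 0 j - w' 0 j * bidual F' F w' 0 i.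
    by rewrite evalB !evalM !evalX !gE.
  have /FF'E/(_ w F'w) : kills_dual F M; last first.
    by rewrite ME => /eqP; rewrite subr_eq0 => /eqP.
  by move=> v Fv; rewrite ME; have [a ->] := bid v Fv; rewrite !mxE; ring.
- split; first by exists v1.
  exists (grad F v1); first exact: FF'.
  have [a ua] := scale v1 Fv1; rewrite /bidual -/(bidual F F' v1) ua.
  have a0 : a != 0 by apply: contra_neq u1 => a0; rewrite ua a0 scale0r.
  rewrite (grad_homog _ _ hF) scaler_eq0 expf_eq0 (negbTE a0) andbF /=.
  by apply: contra_neq u1 => w0; rewrite /bidual w0 (grad_homog0 hF').
Qed.

End Biduality.

(** * Generic points and linear maps *)

Section Points.
Variable K : fieldType.
Implicit Types (P Q R : pplane K) (v w : 'rV[K]_3).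

Lemma hcoord_neq0 Q v : hcoord Q v -> v != 0.
Proof.
by move=> E; have := valP Q; rewrite /= E dim_vline eqb1.
Qed.

Lemma hcoord_exists Q : exists v, hcoord Q v.
Proof.
exists (vpick (pline Q)); apply/esym/eqP; rewrite eqEdim -memvE memv_pick /=.
rewrite (eqP (valP Q)) dim_vline vpick0 -dimv_eq0.
by have /eqP -> := valP Q.
Qed.

Lemma point_exists v : v != 0 -> exists Q : pplane K, hcoord Q v.
Proof.
by move=> v0; have H : \dim <[v]>%VS == 1%N by [rewrite dim_vline v0];
  exists (PPoint H).
Qed.

Lemma hcoord_inj Q R v : hcoord Q v -> hcoord R v -> Q = R.
Proof. by move=> E E'; apply: val_inj; rewrite /= E E'. Qed.

Lemma hcoord_scale Q v a : hcoord Q v -> a != 0 -> hcoord Q (a *: v).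
Proof.
move=> E a0; rewrite /hcoord E; apply/eqP; rewrite eqEdim.
rewrite -!memvE !dim_vline scaler_eq0 (negbTE a0) /= leqnn andbT.
by apply/vlineP; exists a^-1; rewrite scalerA mulVf ?scale1r.
Qed.

Lemma hcoord_unique Q v w : hcoord Q v -> hcoord Q w ->
  exists2 a, a != 0 & w = a *: v.
Proof.
move=> Ev Ew; have /vlineP[a wE] : w \in <[v]>%VS by rewrite -Ev Ew memv_line.
exists a => //; apply: contra_neq (hcoord_neq0 Ew) => a0.
by rewrite wE a0 scale0r.
Qed.

Lemma vanishE e F Q v : F \is e.-homog -> hcoord Q v ->
  vanish F Q <-> eval F v = 0.
Proof.
move=> hF Qv; split=> [|Fv w Qw]; first exact.
by have [a _ ->] := hcoord_unique Qv Qw; rewrite (eval_homog _ _ hF) Fv mulr0.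
Qed.

End Points.

Section Generic.
Variable K : closedFieldType.
Implicit Types (F G h : {mpoly K[3]}) (P Q R : pplane K) (v w : 'rV[K]_3).

(** On an irreducible curve this is the same as holding on a dense open subset; a product of two
    witnesses [h] is again a witness, which gives stability under intersection. *)
Definition generic F (P : pplane K -> Prop) := exists e h,
  [/\ h \is e.-homog, ~ vz F h &
    forall Q v, hcoord Q v -> eval F v = 0 -> eval h v != 0 -> P Q].

Lemma generic_mono F (P P' : pplane K -> Prop) :
  (forall Q v, hcoord Q v -> eval F v = 0 -> P Q -> P' Q) ->
  generic F P -> generic F P'.
Proof.
move=> PP' [e [h [hh nh H]]]; exists e, h; split=> // Q v Qv Fv hv.
exact: (PP' Q v Qv Fv (H Q v Qv Fv hv)).
Qed.

Section Curve.
Variables (d : nat) (F : {mpoly K[3]}).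
Hypothesis irrF : irreducible_form d.+2 F.
Let hF : F \is d.+2.-homog. Proof. by case: irrF. Qed.

Lemma generic_all (P : pplane K -> Prop) :
  (forall Q v, hcoord Q v -> eval F v = 0 -> P Q) -> generic F P.
Proof.
move=> H; exists 0%N, 1; split=> [|/(_ 0 (eval_homog0 hF))|Q v Qv Fv _].
- exact: dhomog1.
- by rewrite -mpolyC1 evalC => /eqP; rewrite oner_eq0.
- exact: (H _ v).
Qed.

Lemma generic_and (P P' : pplane K -> Prop) :
  generic F P -> generic F P' -> generic F (fun Q => P Q /\ P' Q).
Proof.
move=> [e [h [hh nh H]]] [e' [h' [hh' nh' H']]].
exists (e + e')%N, (h * h'); split; first exact: dhomogM.
  by case/(vz_prime irrF).
move=> Q v Qv Fv; rewrite evalM mulf_eq0 negb_or => /andP[hv h'v].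
by split; [exact: (H _ v) | exact: (H' _ v)].
Qed.

(** Points have nonzero coordinate vectors; the factor ['X_o0] discards the zero vector and is then
    cancelled by primality. *)
Lemma vz_projective G :
  (forall v, v != 0 -> eval F v = 0 -> eval G v = 0) -> vz F G.
Proof.
move=> H; have : vz F ('X_o0 * G);
  last by case/(vz_prime irrF) => // /(vzX irrF isT).
move=> v Fv; rewrite evalM evalX; have [->|v0] := eqVneq v 0.
  by rewrite mxE mul0r.
by rewrite H ?mulr0.
Qed.

Lemma generic_vz e G : G \is e.-homog ->
  generic F (fun Q => exists2 v, hcoord Q v & eval G v = 0) -> vz F G.
Proof.
move=> hG [e' [h [hh nh H]]].
have : vz F (h * G); last by case/(vz_prime irrF).
apply: vz_projective => v v0 Fv; rewrite evalM.
have [->|hv] := eqVneq (eval h v) 0; first by rewrite mul0r.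
have [Q Qv] := point_exists v0; have [w Qw Gw] := H Q v Qv Fv hv.
have [a _ ->] := hcoord_unique Qw Qv.
by rewrite (eval_homog _ _ hG) Gw !mulr0.
Qed.

Lemma generic_exists (P : pplane K -> Prop) : generic F P ->
  exists Q v, [/\ hcoord Q v, eval F v = 0 & P Q].
Proof.
move=> [e [h [hh nh H]]]; apply: contrapT => nex; apply: nh.
apply: vz_projective => v v0 Fv; apply: contrapT => /eqP hv.
have [Q Qv] := point_exists v0; apply: nex; exists Q, v; split=> //.
exact: (H _ v).
Qed.

Lemma curveE Q v : hcoord Q v -> curve_of F Q <-> eval F v = 0.
Proof. exact: vanishE hF. Qed.

(** A dense set is nonempty, since otherwise the constant 1 would vanish on its closure; and a
    closed set missing a point lies in the zeros of a form that is nonzero at this point. *)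
Lemma dense_open_generic U : dense_open (curve_of F) U -> generic F U.
Proof.
move=> [[Z clZ UE] dU].
have [R UR] : exists R, U R.
  apply: contrapT => nex.
  have [Q [v [Qv Fv _]]] := generic_exists (generic_all (P := fun=> True)
    (fun _ _ _ _ => I)).
  have := dU Q ((curveE Qv).2 Fv) 0%N 1 (dhomog1 _ _).
  move=> /(_ (fun R UR => False_ind _ (nex (ex_intro _ R UR))) v Qv).
  by rewrite -mpolyC1 evalC => /eqP; rewrite oner_eq0.
move: (UR); rewrite UE => -[DR nZR].
have [e [h [hh hZ nhR]]] : exists e h, [/\ h \is e.-homog,
    forall Q, Z Q -> vanish h Q & ~ vanish h R].
  apply: contrapT => nex; apply: nZR; rewrite -clZ => e h hh hZ.
  by apply: contrapT => nhR; apply: nex; exists e, h.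
have [v Rv] := hcoord_exists R.
exists e, h; split=> // [Fh|Q w Qw Fw hw].
  by apply: nhR; apply/(vanishE hh Rv)/Fh/(curveE Rv).
split; first exact/(curveE Qw).
by move/hZ/(vanishE hh Qw)/eqP; rewrite (negbTE hw).
Qed.

Lemma generic_dense_open (P : pplane K -> Prop) : generic F P ->
  exists2 U, dense_open (curve_of F) U & forall Q, U Q -> P Q.
Proof.
move=> [e [h [hh nh H]]]; exists (curve_of F `\` vanish h); last first.
  move=> Q [DQ nhQ]; have [v Qv] := hcoord_exists Q.
  apply: (H Q v Qv); first exact/(curveE Qv).
  by apply: contra_not_neq nhQ => /(vanishE hh Qv).
split.
  exists (vanish h) => //; apply/seteqP; split=> Q hQ; first exact: (hQ e h hh).
  by move=> e' G hG; apply.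
move=> Q DQ e' G hG GU; have [v Qv] := hcoord_exists Q.
apply/(vanishE hG Qv); suff : vz F G by apply; apply/(curveE Qv).
have : vz F (h * G); last by case/(vz_prime irrF).
apply: vz_projective => w w0 Fw; rewrite evalM.
have [->|hw] := eqVneq (eval h w) 0; first by rewrite mul0r.
have [R Rw] := point_exists w0.
have GR : vanish G R; last by rewrite (GR w Rw) mulr0.
apply: GU; split; first exact/(curveE Rw).
by move/(vanishE hh Rw)/eqP; rewrite (negbTE hw).
Qed.

Lemma agreeP (T : Type) (f g : prel K T) :
  agree (curve_of F) f g <-> generic F (fun Q => forall R : T, f Q R <-> g Q R).
Proof.
split=> [[U /dense_open_generic gU H]|/generic_dense_open[U dU H]].
  by apply: generic_mono gU => Q v _ _ UQ R; apply: H.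
by exists U => // Q R /H.
Qed.

Lemma agree_sym (T : Type) (f g : prel K T) :
  agree (curve_of F) f g -> agree (curve_of F) g f.
Proof. by move=> [U dU H]; exists U => // Q R UQ; split=> /H; apply. Qed.

Lemma agree_trans (T : Type) (f g k : prel K T) :
  agree (curve_of F) f g -> agree (curve_of F) g k -> agree (curve_of F) f k.
Proof.
move=> /agreeP Hf /agreeP Hg; apply/agreeP.
apply: generic_mono (generic_and Hf Hg) => Q v _ _ [E E'] R.
by rewrite E E'.
Qed.

Lemma agree_on (T : Type) (f g : prel K T) :
  (forall Q v, hcoord Q v -> eval F v = 0 -> forall R : T, f Q R <-> g Q R) ->
  agree (curve_of F) f g.
Proof. by move=> H; apply/agreeP/generic_all. Qed.

Lemma rext_agree f g : agree (curve_of F) f g ->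
  rext (curve_of F) f = rext (curve_of F) g.
Proof.
move=> fg; apply/funext => Q; apply/funext => R; apply/propext.
split=> -[DQ [r [hr ar rQ]]]; split=> //; exists r; split=> //.
  exact: agree_trans (agree_sym fg) ar.
exact: agree_trans fg ar.
Qed.

Definition linear_forms (A : 'M[K]_3) (j : 'I_3) : {mpoly K[3]} :=
  \sum_i A i j *: 'X_i.

Lemma eval_linear_forms A v : \row_j eval (linear_forms A j) v = v *m A.
Proof.
apply/rowP => j; rewrite !mxE eval_sum; apply: eq_bigr => i _.
by rewrite evalZ evalX mulrC.
Qed.

Lemma linmap_formmap A : linmap A = formmap (linear_forms A).
Proof.
apply/funext => Q; apply/funext => R; apply/propext.
by split=> -[v Qv]; [rewrite -eval_linear_forms | rewrite eval_linear_forms];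
  exists v.
Qed.

Definition lin A := rext (curve_of F) (linmap A).

Lemma linmapE A Q R v : hcoord Q v -> linmap A Q R <-> hcoord R (v *m A).
Proof.
move=> Qv; split=> [[w Qw]|Rv]; last by exists v.
have [a a0 ->] := hcoord_unique Qw Qv; rewrite -scalemxAl => Rw.
exact: hcoord_scale.
Qed.

Lemma mulmx_unit_neq0 A v : A \in unitmx -> v != 0 -> v *m A != 0.
Proof.
move=> uA; apply: contra_neq => E.
by rewrite -[v]mulmx1 -(mulmxV uA) mulmxA E mul0mx.
Qed.

(** Forms [r] that agree with [A] generically are parallel to it on the whole curve, because the
    minors are forms vanishing generically. So the maximal extension adds no value. *)
Lemma linE A Q R : A \in unitmx ->
  lin A Q R <-> curve_of F Q /\ linmap A Q R.
Proof.
move=> uA; split=> [[DQ [r [[e hr] ar rQ]]]|[DQ AQ]]; last first.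
  split=> //; exists (linear_forms A); split.
  - by exists 1%N => i; apply: linear_homog.
  - by rewrite linmap_formmap; apply: agree_on.
  - by rewrite -linmap_formmap.
split=> //; case: rQ => v Qv Rr; apply/(linmapE A R Qv).
have par : parallel (v *m A) (\row_i eval (r i) v).
  move=> i j; rewrite -eval_linear_forms !mxE.
  pose M := linear_forms A i * r j - linear_forms A j * r i.
  suff /(_ v ((curveE Qv).1 DQ)) : vz F M.
    by rewrite evalB !evalM => /eqP; rewrite subr_eq0 => /eqP.
  apply: (@generic_vz (1 + e)).
    by apply: rpredB; apply: dhomogM => //; apply: linear_homog.
  have /agreeP := ar; apply: generic_mono => S w Sw Fw H.
  have [T Tw] := point_exists (mulmx_unit_neq0 uA (hcoord_neq0 Sw)).
  have /H[u Su Tu] : linmap A S T by exists w.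
  exists u => //; rewrite evalB !evalM.
  have [a a0 wE] := hcoord_unique Su Sw; rewrite wE -scalemxAl in Tw.
  have [b b0 E] := hcoord_unique Tw Tu.
  have Er k : eval (r k) u = b * a * eval (linear_forms A k) u.
    have := congr1 (fun x : 'rV[K]_3 => x 0 k) E.
    by rewrite -eval_linear_forms !mxE mulrA.
  by rewrite !Er; ring.
have [a E] := parallel_scale (mulmx_unit_neq0 uA (hcoord_neq0 Qv)) par.
have a0 : a != 0.
  by apply: contra_neq (hcoord_neq0 Rr) => a0; rewrite E a0 scale0r.
rewrite E in Rr; rewrite -[v *m A]scale1r -(mulVf a0) -scalerA.
by apply: hcoord_scale => //; rewrite invr_eq0.
Qed.

Lemma lin_agree A : A \in unitmx -> agree (curve_of F) (lin A) (linmap A).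
Proof.
move=> uA; apply: agree_on => Q v Qv Fv R; split; first by case/(linE _ _ uA).
by move=> H; apply/(linE _ _ uA); split=> //; apply/(curveE Qv).
Qed.

Lemma rext_lin A : A \in unitmx -> lin A = rext (curve_of F) (lin A).
Proof. by move=> uA; apply/esym/rext_agree/lin_agree. Qed.

Lemma rid_lin : rid (curve_of F) = lin 1%:M.
Proof.
apply: rext_agree; apply: agree_on => Q v Qv Fv R; rewrite (linmapE _ _ Qv).
rewrite mulmx1; split=> [<- //|Rv]; exact: hcoord_inj Qv Rv.
Qed.

Definition preserves (A : 'M[K]_3) :=
  exists2 c, c != 0 & forall v, eval F (v *m A) = c * eval F v.

Lemma rcomp_lin A B : A \in unitmx -> B \in unitmx -> preserves A ->
  rcomp (curve_of F) (lin B) (lin A) = lin (A *m B).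
Proof.
move=> uA uB [c c0 pA]; apply: rext_agree; apply: agree_on => Q v Qv Fv S.
rewrite (linmapE _ _ Qv) mulmxA; split.
  move=> [R /(linE _ _ uA)[_ /(linmapE _ _ Qv) Rv] /(linE _ _ uB)[_]].
  by move/(linmapE _ _ Rv).
move=> Sv; have [R Rv] := point_exists (mulmx_unit_neq0 uA (hcoord_neq0 Qv)).
exists R; first by apply/(linE _ _ uA); split; [apply/(curveE Qv) | exists v].
apply/(linE _ _ uB); split; last exact/(linmapE _ _ Rv).
by apply/(curveE Rv); rewrite pA Fv mulr0.
Qed.

Lemma rational_mapP E f : rational_map (curve_of F) E f <->
  f = rext (curve_of F) f /\ generic F (fun Q => exists2 R, E R & f Q R).
Proof.
split=> -[fE H]; split=> //.
  case: H => U /dense_open_generic gU H.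
  by apply: generic_mono gU => Q v _ _ /H.
by have [U dU HU] := generic_dense_open H; exists U.
Qed.

Lemma subst_linear A v : eval (subst (linear_forms A) F) v = eval F (v *m A).
Proof. by rewrite eval_subst eval_linear_forms. Qed.

(** The transformed equation is a multiple of [F] of the same degree, hence a scalar multiple,
    nonzero as [A] is invertible. *)
Lemma preserves_generic A : A \in unitmx -> vz F (subst (linear_forms A) F) ->
  preserves A.
Proof.
move=> uA /(vz_same irrF)[|c E].
  by rewrite -[d.+2]muln1; apply: subst_homog => // i; apply: linear_homog.
have EA v : eval F (v *m A) = c * eval F v by rewrite -subst_linear E evalZ.
exists c => //; have [_ F0 _ _] := irrF; apply: contra_neq F0 => c0.
apply: eval_ext => v; rewrite eval0 -[v]mulmx1 -(mulVmx uA) mulmxA EA.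
by rewrite c0 mul0r.
Qed.

Lemma rational_map_lin A : A \in unitmx ->
  rational_map (curve_of F) (curve_of F) (lin A) <-> preserves A.
Proof.
move=> uA; split=> [/rational_mapP[_ H]|[c c0 pA]]; last first.
  apply/rational_mapP; split; first exact: rext_lin.
  apply: generic_all => Q v Qv Fv.
  have [R Rv] := point_exists (mulmx_unit_neq0 uA (hcoord_neq0 Qv)).
  exists R; first by apply/(curveE Rv); rewrite pA Fv mulr0.
  by apply/(linE _ _ uA); split; [apply/(curveE Qv) | exists v].
apply: preserves_generic => //; apply: (@generic_vz (d.+2 * 1)).
  by apply: subst_homog => // i; apply: linear_homog.
apply: generic_mono H => Q v Qv _ [R DR /(linE _ _ uA)[_ /(linmapE _ _ Qv) Rv]].
by exists v; rewrite // subst_linear; apply/(curveE Rv).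
Qed.

Lemma preserves_inv A : A \in unitmx -> preserves A -> preserves (invmx A).
Proof.
move=> uA [c c0 pA]; exists c^-1; first by rewrite invr_eq0.
move=> v; apply: (mulfI c0); rewrite -pA -mulmxA mulVmx // mulmx1 mulrA mulfV //.
by rewrite mul1r.
Qed.

Lemma preserves_mul A B : preserves A -> preserves B -> preserves (A *m B).
Proof.
move=> [c c0 pA] [c' c'0 pB]; exists (c' * c); first by rewrite mulf_neq0.
by move=> v; rewrite mulmxA pB pA mulrA.
Qed.

Lemma Bir_lin A : A \in unitmx -> preserves A -> Bir (curve_of F) (lin A).
Proof.
move=> uA pA; split; first exact/rational_map_lin.
have uV : invmx A \in unitmx by rewrite unitmx_inv.
have pV := preserves_inv uA pA.
exists (lin (invmx A)); split; first exact/rational_map_lin.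
  by rewrite rcomp_lin // mulmxV // rid_lin.
by rewrite rcomp_lin // mulVmx // rid_lin.
Qed.

Lemma lin_scale c A : c != 0 -> lin (c *: A) = lin A.
Proof.
move=> c0; rewrite /lin; congr (rext _ _); apply/funext => Q; apply/funext => R.
have [v Qv] := hcoord_exists Q; apply/propext; rewrite !(linmapE _ _ Qv).
rewrite -scalemxAr; split=> Rv; last exact: hcoord_scale.
rewrite -[v *m A]scale1r -(mulVf c0) -scalerA.
by apply: hcoord_scale => //; rewrite invr_eq0.
Qed.

End Curve.
End Generic.

(** * Central collineations *)

Section Matrices.
Variable K : fieldType.
Implicit Types (v w p : 'rV[K]_3) (A : 'M[K]_3) (xi eta : 'cV[K]_3).

Lemma delta_mulmx A (i j : 'I_3) :
  ((delta_mx 0 i : 'rV[K]_3) *m A) 0 j = A i j.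
Proof. by rewrite -rowE mxE. Qed.

Lemma addE v w (i : 'I_3) : (v + w) 0 i = v 0 i + w 0 i.
Proof. by rewrite mxE. Qed.

Lemma deltaE (i j : 'I_3) : (delta_mx 0 i : 'rV[K]_3) 0 j = (j == i)%:R.
Proof. by rewrite mxE eqxx. Qed.

(** Basis vectors show that [A] is diagonal, their sums with the first one that the diagonal is
    constant. *)
Lemma parallel_scalar A : (forall v, parallel v (v *m A)) ->
  exists c, A = c%:M.
Proof.
move=> H; exists (A o0 o0).
have E i j : i != j -> A i j = 0.
  move=> ij; have := H (delta_mx 0 i) i j; rewrite !delta_mulmx !mxE !eqxx.
  by rewrite mul1r (eq_sym j) (negbTE ij) mul0r.
have D i : A i i = A o0 o0.
  have [->//|i0] := eqVneq i o0.
  have := H (delta_mx 0 i + delta_mx 0 o0) i o0.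
  rewrite mulmxDl !addE !delta_mulmx !deltaE !eqxx (eq_sym o0) (negbTE i0).
  by rewrite (E i o0) // (E o0 i) 1?eq_sym // !addr0 !add0r !mul1r => ->.
apply/matrixP => i j; rewrite !mxE.
by have [->|ij] := eqVneq i j; rewrite ?D ?mulr1n // E.
Qed.

Definition det3 v1 v2 v3 : K :=
  v1 0 o0 * (v2 0 o1 * v3 0 o2 - v2 0 o2 * v3 0 o1)
  - v1 0 o1 * (v2 0 o0 * v3 0 o2 - v2 0 o2 * v3 0 o0)
  + v1 0 o2 * (v2 0 o0 * v3 0 o1 - v2 0 o1 * v3 0 o0).

(* A linear map preserving every line through [p] is a homology or an elation
   with centre [p], up to scaling. *)
Lemma central_collineation p A : p != 0 -> (forall v, det3 p v (v *m A) = 0) ->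
  exists l xi, A = l%:M + xi *m p.
Proof.
move=> p0 H.
have [i pi] := row_neq0 p0.
have [j [k [ij ik jk [cov HT]]]] : exists j k, [/\ i != j, i != k, j != k &
    (forall l, [\/ l = i, l = j | l = k]) /\
    forall v, p 0 i * (v 0 j * (v *m A) 0 k - v 0 k * (v *m A) 0 j)
      - p 0 j * (v 0 i * (v *m A) 0 k - v 0 k * (v *m A) 0 i)
      + p 0 k * (v 0 i * (v *m A) 0 j - v 0 j * (v *m A) 0 i) = 0].
  by case: (ord3P i) => ->; [exists o1, o2 | exists o0, o2 | exists o0, o1];
     split=> //; split=> [l|v];
     first [by case: (ord3P l) => ->;
              do ?[by apply: Or31 | by apply: Or32 | by apply: Or33]
           | have := H v; rewrite /det3 => E;
             first [rewrite -[RHS]E; ring | rewrite -[RHS]oppr0 -E; ring]].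
have ji : (j == i) = false by rewrite eq_sym (negbTE ij).
have ki : (k == i) = false by rewrite eq_sym (negbTE ik).
have kj : (k == j) = false by rewrite eq_sym (negbTE jk).
(* The condition is quadratic in [v]: basis vectors and sums of two of them carry all its
   information. *)
have T2 (a b : 'I_3) := HT (delta_mx 0 a + delta_mx 0 b).
have T1 (a : 'I_3) := HT (delta_mx 0 a).
have simp := (delta_mulmx, eqxx, negbTE ij, negbTE ik, negbTE jk, ji, ki, kj).
have Ti := T1 i; have Tj := T1 j; have Tk := T1 k.
have Tij := T2 i j; have Tik := T2 i k; have Tjk := T2 j k.
rewrite !mulmxDl !addE !simp !deltaE !simp /= in Ti Tj Tk Tij Tik Tjk.
have ajk : A j k = p 0 k * A j i / p 0 i.
  apply: (mulfI pi); apply/eqP; rewrite -subr_eq0; apply/eqP.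
  by rewrite -[RHS]Tj; field.
have akj : A k j = p 0 j * A k i / p 0 i.
  apply: (mulfI pi); apply/eqP; rewrite -subr_eq0; apply/eqP.
  by rewrite -[RHS]oppr0 -Tk; field.
have akk : A k k = A j j - A j i / p 0 i * p 0 j + A k i / p 0 i * p 0 k.
  apply: (mulfI pi); apply/eqP; rewrite -subr_eq0; apply/eqP.
  by rewrite -[RHS]Tjk ajk akj; field.
pose l := A j j - A j i / p 0 i * p 0 j.
have aik : A i k = (A i i - l) / p 0 i * p 0 k.
  apply: (mulfI pi); apply/eqP; rewrite -subr_eq0; apply/eqP.
  have -> : (0 : K) = 0 - 0 - 0 by rewrite !subr0.
  by rewrite -{1}Tij -{1}Ti -Tj /l ajk; field.
have aij : A i j = (A i i - l) / p 0 i * p 0 j.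
  apply: (mulfI pi); apply/eqP; rewrite -subr_eq0; apply/eqP.
  have -> : (0 : K) = - (0 - 0 - 0) by rewrite !subr0 oppr0.
  by rewrite -{1}Tik -{1}Ti -Tk /l akj akk; field.
exists l, (\col_a if a == i then (A i i - l) / p 0 i else A a i / p 0 i).
apply/matrixP => a b; rewrite !mxE big_ord1 !mxE.
case: (cov a) => ->; case: (cov b) => ->; rewrite ?simp ?mulr1n ?mulr0n ?add0r.
- by field.
- by rewrite aij.
- by rewrite aik.
- by field.
- by rewrite /l; ring.
- by rewrite ajk; ring.
- by field.
- by rewrite akj; ring.
- by rewrite akk /l; ring.
Qed.

Lemma central_scalar_neq0 p xi l : l%:M + xi *m p \in unitmx -> l != 0.
Proof.
apply: contraTneq => ->; rewrite raddf0 add0r -row_free_unit /row_free.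
rewrite neq_ltn; apply/orP; left; apply: leq_ltn_trans (mxrankM_maxl _ _) _.
exact: leq_ltn_trans (rank_leq_col _) _.
Qed.

Definition pair p xi : K := (p *m xi) 0 0.

Lemma pairDl v w xi : pair (v + w) xi = pair v xi + pair w xi.
Proof. by rewrite /pair mulmxDl mxE. Qed.

Lemma pairZl c v xi : pair (c *: v) xi = c * pair v xi.
Proof. by rewrite /pair -scalemxAl mxE. Qed.

Lemma pairDr v xi eta : pair v (xi + eta) = pair v xi + pair v eta.
Proof. by rewrite /pair mulmxDr mxE. Qed.

Lemma pairZr c v xi : pair v (c *: xi) = c * pair v xi.
Proof. by rewrite /pair -scalemxAr mxE. Qed.

Lemma pairE p xi : p *m xi = (pair p xi)%:M.
Proof. exact: mx11_scalar. Qed.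

Lemma rank1_mul p xi eta :
  (xi *m p) *m (eta *m p) = pair p eta *: (xi *m p).
Proof. by rewrite mulmxA -(mulmxA xi) pairE mul_mx_scalar scalemxAl. Qed.

Lemma central_mul p xi eta :
  (1%:M + xi *m p) *m (1%:M + eta *m p) =
    1%:M + (xi + eta + pair p eta *: xi) *m p.
Proof.
rewrite mulmxDl mul1mx mulmxDr mulmx1 rank1_mul !mulmxDl scalemxAl.
by rewrite -!addrA; congr (_ + _); rewrite addrCA !addrA.
Qed.

(** This scalar is the eigenvalue of the collineation at [p]. *)
Lemma central_pair_neq0 p xi : p != 0 -> 1%:M + xi *m p \in unitmx ->
  1 + pair p xi != 0.
Proof.
move=> p0 uA; apply: contra_neq p0 => E.
rewrite -[p]mulmx1 -(mulmxV uA) mulmxA.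
have -> : p *m (1%:M + xi *m p) = (1 + pair p xi) *: p.
  by rewrite mulmxDr mulmx1 mulmxA pairE mul_scalar_mx scalerDl scale1r.
by rewrite E scale0r mul0mx.
Qed.

Lemma central_inv p xi : 1 + pair p xi != 0 ->
  (1%:M + xi *m p) *m (1%:M + (- (1 + pair p xi)^-1 *: xi) *m p) = 1%:M.
Proof.
move=> n0; rewrite central_mul.
rewrite pairZr.
rewrite -[X in X + _ + _]scale1r -!scalerDl.
set c := (X in X *: _); have -> : c = 0 by rewrite /c; field.
by rewrite scale0r mul0mx addr0.
Qed.

Lemma central_unit p xi : 1 + pair p xi != 0 -> 1%:M + xi *m p \in unitmx.
Proof. by move/central_inv/mulmx1_unit => []. Qed.

Lemma central_invE p xi : 1 + pair p xi != 0 ->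
  invmx (1%:M + xi *m p) = 1%:M + (- (1 + pair p xi)^-1 *: xi) *m p.
Proof.
move=> n0; have uA := central_unit n0.
have := congr1 (mulmx (invmx (1%:M + xi *m p))) (central_inv n0).
by rewrite mulmxA mulVmx // mul1mx mulmx1 => ->.
Qed.

End Matrices.

(** * The linear automorphisms fixing the lines through a point *)

Section LinearGroup.
Variable K : closedFieldType.
Hypothesis charK0 : [pchar K] =i pred0.
Variables (d : nat) (F : {mpoly K[3]}).
Hypothesis irrF : irreducible_form d.+3 F.
Implicit Types (P Q R : pplane K) (v w p : 'rV[K]_3) (A B : 'M[K]_3).
Implicit Types xi eta : 'cV[K]_3.
Let hF : F \is d.+3.-homog. Proof. by case: irrF. Qed.

Lemma preserves_scale c A : c != 0 -> preserves F A -> preserves F (c *: A).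
Proof.
move=> c0 [c' c'0 pA]; exists (c ^+ d.+3 * c').
  by rewrite mulf_neq0 ?expf_neq0.
by move=> v; rewrite -scalemxAr (eval_homog _ _ hF) pA mulrA.
Qed.

(** The minors of [v *m A] and [v *m B] are quadratic forms vanishing on a curve of degree at least
    3, hence zero; every vector is then an eigenvector of [invmx A *m B]. *)
Lemma lin_inj A B : A \in unitmx -> B \in unitmx -> lin F A = lin F B ->
  exists2 c, c != 0 & B = c *: A.
Proof.
move=> uA uB AB.
have par v : parallel (v *m A) (v *m B).
  move=> i j.
  pose M := linear_forms A i * linear_forms B j
    - linear_forms A j * linear_forms B i.
  have hM : M \is 2.-homog.
    by apply: rpredB; apply: (@dhomogM _ _ _ 1 _ 1); apply: linear_homog.
  have ME w : eval M w =
      (w *m A) 0 i * (w *m B) 0 j - (w *m A) 0 j * (w *m B) 0 i.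
    by rewrite -!eval_linear_forms !mxE evalB !evalM.
  suff M0 : M = 0.
    by apply/eqP; rewrite -subr_eq0 -ME M0 eval0.
  apply: (vz_small irrF hM) => //; apply: (vz_projective irrF) => w w0 Fw.
  have [Q Qw] := point_exists w0.
  have [R Rw] := point_exists (mulmx_unit_neq0 uA w0).
  have : lin F A Q R.
    by apply/(linE irrF _ _ uA); split; [apply/(curveE irrF Qw) | exists w].
  rewrite AB => /(linE irrF _ _ uB)[_ /(linmapE _ _ Qw) Rw'].
  by have [a _ E] := hcoord_unique Rw Rw'; rewrite ME E !mxE; ring.
have [c E] : exists c, invmx A *m B = c%:M.
  apply: parallel_scalar => v; have := par (v *m invmx A).
  by rewrite -!mulmxA mulVmx // mulmx1 mulmxA.
have BE : B = c *: A.
  by rewrite -[B]mul1mx -(mulmxV uA) -mulmxA E mul_mx_scalar.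
exists c => //; apply: contraTneq uB => c0.
by rewrite BE c0 scale0r unitmxE det0 unitr0.
Qed.

Lemma line_shift p v c :
  (<[p]> + <[v + c *: p]> = <[p]> + <[v]>)%VS.
Proof.
have sub u a : (<[p]> + <[u + a *: p]> <= <[p]> + <[u]>)%VS.
  rewrite subv_add addvSl /= -memvE addrC; apply: memv_add; last exact: memv_line.
  by rewrite memvZ ?memv_line.
apply/eqP; rewrite eqEsubv sub /=.
by have := sub (v + c *: p) (- c); rewrite scaleNr addrK.
Qed.

Lemma mul_central v p xi : v *m (1%:M + xi *m p) = v + pair v xi *: p.
Proof. by rewrite mulmxDr mulmx1 mulmxA pairE mul_scalar_mx. Qed.

(** Commuting with the projection says that [det3 p v (v *m A)] vanishes on the curve; being
    quadratic, it vanishes identically, and [central_collineation] applies. Scaling then makes the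
    scalar part 1. *)
Lemma G0P P p sigma : hcoord P p -> G0 (curve_of F) P sigma <->
  exists xi, [/\ 1%:M + xi *m p \in unitmx, preserves F (1%:M + xi *m p)
    & sigma = lin F (1%:M + xi *m p)].
Proof.
move=> Pp; have p0 := hcoord_neq0 Pp; split; last first.
  move=> [xi [uA pA ->]]; split; last first.
    by exists (1%:M + xi *m p) => //; exact: (lin_agree irrF uA).
  split; first exact: (Bir_lin irrF uA pA).
  apply: (agree_on irrF) => Q v Qv Fv L; rewrite /relcomp /proj_from.
  have DQ : curve_of F Q by apply/(curveE irrF Qv).
  have vA := mul_central v p xi.
  have n1 := central_pair_neq0 p0 uA.
  split.
    move=> [R /(linE irrF _ _ uA)[_ /(linmapE _ _ Qv) Rv] [RP ->]]; split.
      apply: contra_neq RP => QP; rewrite QP in Qv.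
      have [a a0 vE] := hcoord_unique Pp Qv.
      have pv : pair v xi = a * pair p xi by rewrite vE pairZl.
      apply: (hcoord_inj Rv); rewrite vA vE -vE pv vE -scalerDl.
      by rewrite -{1}[a]mulr1 -mulrDr; apply: hcoord_scale; rewrite ?mulf_neq0.
    by rewrite Pp Qv Rv vA line_shift.
  move=> [QP ->]; have [R Rv] := point_exists (mulmx_unit_neq0 uA (hcoord_neq0 Qv)).
  exists R; first by apply/(linE irrF _ _ uA); split=> //; apply/(linmapE _ _ Qv).
  split; last by rewrite Pp Qv Rv vA line_shift.
  apply: contra_neq QP => RP; rewrite RP in Rv.
  have [a a0 E] := hcoord_unique Pp Rv.
  have vE : v = (a - pair v xi) *: p.
    by rewrite scalerBl -E vA addrK.
  apply: (hcoord_inj Qv); rewrite vE; apply: hcoord_scale => //.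
  by apply: contra_neq (hcoord_neq0 Qv) => a1; rewrite vE a1 scale0r.
move=> [[[sr _] proj] [A uA sA]].
have sE : sigma = lin F A.
  by case: sr => -> _; apply: (rext_agree irrF).
rewrite sE in sr proj *.
have pA := (rational_map_lin irrF uA).1 sr.
pose T : {mpoly K[3]} :=
  p 0 o0 *: ('X_o1 * linear_forms A o2 - 'X_o2 * linear_forms A o1)
  - p 0 o1 *: ('X_o0 * linear_forms A o2 - 'X_o2 * linear_forms A o0)
  + p 0 o2 *: ('X_o0 * linear_forms A o1 - 'X_o1 * linear_forms A o0).
have TE v : eval T v = det3 p v (v *m A).
  rewrite /det3 -eval_linear_forms !mxE /T evalD evalB !evalZ !evalB !evalM.
  by rewrite !evalX.
have hT : T \is 2.-homog.
  have h i j : 'X_i * linear_forms A j \is 2.-homog.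
    apply: (@dhomogM _ _ _ 1 _ 1); last exact: linear_homog.
    by rewrite dhomogX /= mdeg1.
  by rewrite rpredD // ?rpredB // ?rpredZ // rpredB.
have T0 : T = 0.
  apply: (vz_small irrF hT) => //; apply: (generic_vz irrF hT).
  have /(agreeP irrF) := proj; apply: generic_mono => Q v Qv Fv H.
  exists v => //; rewrite TE /det3.
  have [QP|QP] := eqVneq Q P.
    rewrite QP in Qv; have [a _ ->] := hcoord_unique Pp Qv.
    by rewrite ![(a *: p) 0 _]mxE; ring.
  have /H[R /(linE irrF _ _ uA)[_ /(linmapE _ _ Qv) Rv] [_ E]] :
    proj_from P Q (pline P + pline Q)%VS by [].
  have : v *m A \in (<[p]> + <[v]>)%VS.
    by rewrite -Pp -Qv E Rv; apply: (subvP (addvSr _ _)); apply: memv_line.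
  case/memv_addP => _ /vlineP[a ->] [_ /vlineP[b ->] ->].
  by rewrite ![(a *: p + b *: v) 0 _]mxE ![(a *: p) 0 _]mxE ![(b *: v) 0 _]mxE; ring.
have [l [xi AE]] : exists l xi, A = l%:M + xi *m p.
  by apply: central_collineation p0 _ => v; rewrite -TE T0 eval0.
have l0 : l != 0 by apply: (@central_scalar_neq0 _ p xi); rewrite -AE.
have lV : l^-1 != 0 by rewrite invr_eq0.
have BE : 1%:M + (l^-1 *: xi) *m p = l^-1 *: A.
  by rewrite AE scalerDr scale_scalar_mx mulVf // -scalemxAl.
exists (l^-1 *: xi); rewrite BE; split.
- by rewrite unitmxZ // unitfE.
- exact: preserves_scale.
- by rewrite lin_scale.
Qed.

(* The restriction of [F] to a line through the centre would be a periodic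
   polynomial, hence constant. *)
Lemma no_elation p xi : p != 0 -> pair p xi = 0 ->
  preserves F (1%:M + xi *m p) -> xi = 0.
Proof.
move=> p0 pxi [c c0 pA].
have period v s : eval F (v + (s + 1) *: (pair v xi *: p)) =
    c * eval F (v + s *: (pair v xi *: p)).
  rewrite -pA mul_central; congr (eval F _).
  have -> : pair (v + s *: (pair v xi *: p)) xi = pair v xi.
    by rewrite pairDl !pairZl pxi !mulr0 addr0.
  by rewrite scalerDl scale1r addrA.
have lineE v : line F v (pair v xi *: p) =
    ((line F v (pair v xi *: p))`_0)%:P.
  set f := line F v _.
  have fE : f \Po ('X + 1%:P) = c *: f.
    apply: poly_ext => s; rewrite horner_comp hornerZ !horner_line.
    by rewrite hornerD hornerX hornerC period.
  have [f0|f0] := eqVneq f 0; first by rewrite f0 coef0.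
  (* A translation of the variable keeps the leading coefficient. Then [f] takes one value at all
     natural numbers, which are distinct in characteristic 0. *)
  have c1 : c = 1.
    have := congr1 lead_coef fE; rewrite lead_coef_comp ?size_XaddC //.
    rewrite lead_coefXaddC expr1n mulr1 lead_coefZ.
    move/eqP; rewrite -{1}[lead_coef f]mul1r -subr_eq0 -mulrBl mulf_eq0.
    by rewrite lead_coef_eq0 (negbTE f0) orbF subr_eq0 eq_sym => /eqP.
  have fn n : f.[n%:R] = f`_0.
    elim: n => [|n IH]; first by rewrite horner_coef0.
    by rewrite !horner_line -natr1 period c1 mul1r -horner_line.
  apply/eqP; rewrite -subr_eq0; apply/eqP.
  pose N := size (f - (f`_0)%:P).
  apply: (@roots_geq_poly_eq0 _ _ [seq n%:R | n <- iota 0 N]).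
  - apply/allP => _ /mapP[n _ ->].
    by rewrite /root hornerD hornerN hornerC fn subrr.
  - rewrite map_inj_uniq ?iota_uniq // => m n /eqP.
    wlog mn : m n / (m <= n)%N => [W|].
      have [mn|/ltnW nm] := leqP m n; first exact: W.
      by rewrite eq_sym => E; apply/esym/W.
    rewrite eq_sym -subr_eq0 -natrB // ((pcharf0P K).1 charK0) subn_eq0 => nm.
    by apply/eqP; rewrite eqn_leq mn.
  - by rewrite size_map size_iota.
have D0 v : pair v xi * eval (\sum_i p 0 i *: F^`M(i)) v = 0.
  have := congr1 (fun f : {poly K} => f^`().[0]) (lineE v).
  rewrite /= derivC horner0 deriv_line horner_sum eval_sum mulr_sumr => E.
  rewrite -[RHS]E; apply: eq_bigr => i _.
  by rewrite hornerZ horner_line scale0r addr0 evalZ mxE mulrA.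
(* The derivative along [p] is nonzero by [nondegenerate], so the linear form with coefficients [xi]
   is zero. *)
have : (\sum_i xi i 0 *: 'X_i) * (\sum_i p 0 i *: F^`M(i)) = 0.
  apply: eval_ext => v; rewrite eval0 evalM -[RHS](D0 v); congr (_ * _).
  by rewrite eval_sum /pair mxE; apply: eq_bigr => i _; rewrite evalZ evalX mulrC.
move/eqP; rewrite mulf_eq0 (negbTE (nondegenerate charK0 irrF p0)) orbF => /eqP E.
apply/colP => i; rewrite mxE; have := congr1 (fun G => G@_U_(i)%MM) E.
by rewrite linear_coef mcoeff0.
Qed.

(* The commutator of two homologies with the same centre is an elation. *)
Lemma common_axis p xi eta : p != 0 ->
  1%:M + xi *m p \in unitmx -> preserves F (1%:M + xi *m p) ->
  1%:M + eta *m p \in unitmx -> preserves F (1%:M + eta *m p) ->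
  xi != 0 -> exists t, eta = t *: xi.
Proof.
move=> p0 uA pA uB pB xi0.
(* [alpha] and [beta] belong to the products of the two homologies in either order, [zeta] to their
   commutator. *)
pose alpha := xi + eta + pair p eta *: xi.
pose beta := eta + xi + pair p xi *: eta.
have pab : pair p alpha = pair p beta by rewrite !pairDr !pairZr; ring.
have uBA : 1%:M + beta *m p \in unitmx by rewrite -central_mul unitmx_mul uB.
have n0 := central_pair_neq0 p0 uBA.
pose zeta := (1 + pair p beta)^-1 *: (alpha - beta).
have pz : pair p zeta = 0.
  by rewrite pairZr (pairDr p alpha (- beta)) -(scaleN1r beta)
    (pairZr (-1) p beta) mulN1r pab subrr mulr0.
have E : (1%:M + zeta *m p) *m (1%:M + beta *m p) = 1%:M + alpha *m p.
  rewrite central_mul; congr (_ + _ *m _).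
  rewrite addrAC -{1}[zeta]scale1r -scalerDl /zeta scalerA mulfV // scale1r.
  by rewrite subrK.
have pzA : preserves F (1%:M + zeta *m p).
  have -> : 1%:M + zeta *m p =
      (1%:M + alpha *m p) *m invmx (1%:M + beta *m p).
    by rewrite -E -mulmxA mulmxV // mulmx1.
  apply: preserves_mul; first by rewrite -central_mul; apply: preserves_mul.
  by apply: preserves_inv => //; rewrite -central_mul; apply: preserves_mul.
have z0 := no_elation p0 pz pzA.
have pxi0 : pair p xi != 0 by apply: contra_neq xi0 => E0; apply: no_elation E0 pA.
exists (pair p eta / pair p xi).
have : alpha = beta.
  apply/eqP; rewrite -subr_eq0; have := z0; move/eqP.
  by rewrite scaler_eq0 invr_eq0 (negbTE n0).
rewrite /alpha /beta [eta + xi]addrC => /addrI E1.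
by rewrite mulrC -scalerA E1 scalerA mulVf ?scale1r.
Qed.

End LinearGroup.

(** * Dual curve and dual point *)

Definition dual_mx (K : fieldType) (A : 'M[K]_3) : 'M[K]_3 := (invmx A)^T.

Section DualMatrix.
Variable K : fieldType.
Implicit Types (A B : 'M[K]_3) (p : 'rV[K]_3) (xi : 'cV[K]_3).

Lemma dual_mx_unit A : (dual_mx A \in unitmx) = (A \in unitmx).
Proof. by rewrite unitmx_tr unitmx_inv. Qed.

Lemma dual_mxK A : dual_mx (dual_mx A) = A.
Proof. by rewrite /dual_mx trmx_inv trmxK invmxK. Qed.

Lemma dual_mxZ c A : A \in unitmx -> c != 0 ->
  dual_mx (c *: A) = c^-1 *: dual_mx A.
Proof.
by move=> uA c0; rewrite /dual_mx invmxZ ?unitmxZ ?unitfE // linearZ.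
Qed.

Lemma invmx_mul A B : A \in unitmx -> B \in unitmx ->
  invmx (A *m B) = invmx B *m invmx A.
Proof.
move=> uA uB; have uAB : A *m B \in unitmx by rewrite unitmx_mul uA.
rewrite -[RHS](mulKmx uAB) !mulmxA mulmxK // -[_ *m A *m _]mulmxA.
by rewrite mulmxV // mulmx1.
Qed.

Lemma dual_mxM A B : A \in unitmx -> B \in unitmx ->
  dual_mx (A *m B) = dual_mx A *m dual_mx B.
Proof. by move=> uA uB; rewrite /dual_mx invmx_mul // trmx_mul. Qed.

Lemma dual_mx_central p xi : 1 + pair p xi != 0 ->
  dual_mx (1%:M + xi *m p) =
    1%:M + (- (1 + pair p xi)^-1 *: p^T) *m xi^T.
Proof.
move=> n0; rewrite /dual_mx central_invE // linearD /= trmx1 trmx_mul linearZ /=.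
by rewrite -scalemxAl -scalemxAr.
Qed.

End DualMatrix.

Section Duality.
Variable K : closedFieldType.
Hypothesis charK0 : [pchar K] =i pred0.
Implicit Types (F G H : {mpoly K[3]}) (P Q R L : pplane K).
Implicit Types (v w p : 'rV[K]_3) (A B : 'M[K]_3).

Lemma grad_preserves F A c v : (forall u, eval F (u *m A) = c * eval F u) ->
  grad F (v *m A) *m A^T = c *: grad F v.
Proof.
move=> pA.
have E : subst (linear_forms A) F = c *: F.
  by apply: eval_ext => u; rewrite eval_subst eval_linear_forms pA evalZ.
apply/rowP => i; have := congr1 (fun G => eval G^`M(i) v) E.
rewrite /= mderiv_subst mderivZ evalZ eval_sum !mxE => <-.
apply: eq_bigr => j _; rewrite evalM eval_subst eval_linear_forms !mxE.
congr (_ * _); rewrite /linear_forms raddf_sum eval_sum (bigD1 i) //=.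
rewrite mderivZ mderivXU eqxx evalZ evalC mulr1 big1 ?addr0 // => k ne.
by rewrite mderivZ mderivXU eq_sym (negbTE ne) evalZ evalC mulr0.
Qed.

Lemma grad_dual_mx F A c v : A \in unitmx ->
  (forall u, eval F (u *m A) = c * eval F u) ->
  grad F (v *m A) = c *: (grad F v *m dual_mx A).
Proof.
move=> uA pA; rewrite scalemxAl -(grad_preserves v pA) -mulmxA.
by rewrite /dual_mx -trmx_mul mulVmx // trmx1 mulmx1.
Qed.

Lemma bidual_scale F F' v : dual_pair F F' -> eval F v = 0 ->
  exists a, bidual F F' v = a *: v.
Proof.
move=> [d [n [[hF _ _ _] [hF' _ _ _] _ [par _] _]]] Fv.
have [->|v0] := eqVneq v 0; last exact: parallel_scale v0 (par v Fv).
by exists 0; rewrite /bidual (grad_homog0 hF) (grad_homog0 hF') scale0r.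
Qed.

(** Away from the zeros of one form, a zero [w] of [F'] is up to a nonzero scalar the gradient of
    [F] at [grad F' w], hence in the image of the Gauss map. *)
Lemma generic_bidual F F' : dual_pair F F' ->
  exists2 j, ~ vz F' (subst (fun i => F'^`M(i)) F^`M(j)) &
    forall w, eval F' w = 0 ->
      eval (subst (fun i => F'^`M(i)) F^`M(j)) w != 0 ->
      exists2 a, a != 0 & bidual F' F w = a *: w.
Proof.
move=> pr; have := dual_pair_sym pr => rp.
case: pr => [d [n [_ _ _ _ [_ [w0 F'w0 b0]]]]].
have gE j w : eval (subst (fun i => F'^`M(i)) F^`M(j)) w = bidual F' F w 0 j.
  by rewrite eval_subst mxE.
have [j bj] := row_neq0 b0.
exists j => [/(_ w0 F'w0)/eqP|w F'w]; first by rewrite gE (negbTE bj).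
rewrite gE; have [a E] := bidual_scale rp F'w => bw; exists a => //.
by apply: contra_neq bw => a0; rewrite E a0 scale0r mxE.
Qed.

Lemma dual_pair_kills F F' k H : dual_pair F F' -> H \is k.-homog ->
  kills_dual F H -> vz F' H.
Proof.
move=> pr hH FH; have [d [n [_ irrF' [_ F'F] _ _]]] := pr.
have [j nj Hj] := generic_bidual pr.
have : vz F' (subst (fun i => F'^`M(i)) F^`M(j) * H);
  last by case/(vz_prime irrF').
move=> w F'w; rewrite evalM.
have [->|gw] := eqVneq (eval (subst (fun i => F'^`M(i)) F^`M(j)) w) 0.
  by rewrite mul0r.
have [a a0 E] := Hj w F'w gw.
have := FH _ (F'F _ F'w); rewrite -/(bidual _ _ _) E (eval_homog _ _ hH) => /eqP.
by rewrite mulf_eq0 expf_eq0 (negbTE a0) andbF /= => /eqP ->; rewrite mulr0.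
Qed.

(** By the chain rule [grad F v *m dual_mx A] is a multiple of the gradient at [v *m A], again a
    point of the curve, so the transformed [F'] still kills the dual curve. *)
Lemma dual_preserves F F' A : dual_pair F F' -> A \in unitmx ->
  preserves F A -> preserves F' (dual_mx A).
Proof.
move=> pr uA [c c0 pA]; have [d [n [_ irrF' [FF' _] _ _]]] := pr.
have [hF' _ _ _] := irrF'.
apply: (preserves_generic irrF'); first by rewrite dual_mx_unit.
apply: (dual_pair_kills pr (k := n.+3 * 1)).
  by apply: subst_homog => // i; apply: linear_homog.
move=> v Fv; rewrite eval_subst eval_linear_forms.
have -> : grad F v *m dual_mx A = c^-1 *: grad F (v *m A).
  by rewrite (grad_dual_mx v uA pA) scalerA mulVf // scale1r.
by rewrite (eval_homog _ _ hF') FF' ?mulr0 // pA Fv mulr0.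
Qed.

Lemma irreducible_form_degree e F : irreducible_form e F -> (0 < e)%N.
Proof.
case: e => // -[hF F0 nF _]; case/negP: nF.
by rewrite mpoly_unit_msize (homog_msize F0 hF).
Qed.

(** Irreducible equations of one curve differ by a nonzero scalar, so the equation hidden in [gauss]
    may be taken to be [F]. *)
Lemma gaussP F d Q L : irreducible_form d.+2 F ->
  gauss (curve_of F) Q L <->
  exists v, [/\ hcoord Q v, eval F v = 0 & hcoord L (grad F v)].
Proof.
move=> irrF; have [hF F0 nF _] := irrF; split; last first.
  move=> [v [Qv Fv Lv]]; split; first exact/(curveE irrF Qv).
  by exists d.+2, F; split=> //; exists v.
move=> [DQ [e [F1 [irrF1 DE [v Qv Lv]]]]].
have Fv : eval F v = 0 by apply/(curveE irrF Qv).
have [hF1 F10 _ irr1] := irrF1; have e0 := irreducible_form_degree irrF1.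
have FF1 : vz F F1.
  apply: (vz_projective irrF) => w w0 Fw; have [R Rw] := point_exists w0.
  by have : curve_of F R; [apply/(curveE irrF Rw) | rewrite DE => /(_ w Rw)].
have [H E] := vz_divides irrF FF1.
have [UF|UH] := irr1 _ _ E; first by rewrite UF in nF.
have : msize H == 1%N by rewrite -mpoly_unit_msize.
case/msize_poly1P => c c0 HE.
have E1 : F1 = c *: F by rewrite E HE mulrC mul_mpolyC.
exists v; split=> //; have -> : grad F v = c^-1 *: grad F1 v.
  apply/rowP => i; rewrite !mxE E1 mderivZ evalZ mulrA mulVf // mul1r //.
by apply: hcoord_scale; rewrite ?invr_eq0.
Qed.

(** A form vanishing at all tangent lines vanishes at the generic zeros of [F'], which are tangent
    lines by [generic_bidual], and therefore at all of them. *)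
Lemma dual_curveE F F' : dual_pair F F' ->
  dual_curve (curve_of F) = curve_of F'.
Proof.
move=> pr; have [d [n [irrF irrF' [FF' F'F] _ _]]] := pr.
have [hF' _ _ _] := irrF'.
apply/seteqP; split=> R HR.
  apply: (HR _ _ hF') => L [Q /(gaussP _ _ irrF)[v [Qv Fv Lv]]].
  by apply/(vanishE hF' Lv)/FF'.
move=> e H hH HL; have [w Rw] := hcoord_exists R.
apply/(vanishE hH Rw); suff : vz F' H by apply; apply/(curveE irrF' Rw).
have [j nj Hj] := generic_bidual pr.
have : vz F' (subst (fun i => F'^`M(i)) F^`M(j) * H);
  last by case/(vz_prime irrF').
apply: (vz_projective irrF') => {Rw}w w0 F'w; rewrite evalM.
have [->|gw] := eqVneq (eval (subst (fun i => F'^`M(i)) F^`M(j)) w) 0.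
  by rewrite mul0r.
have [a a0 E] := Hj w F'w gw.
have [L Lw] := point_exists w0.
have u0 : grad F' w != 0.
  apply: contra_neq w0 => u0; have := E; rewrite /bidual u0.
  have [hF _ _ _] := irrF; rewrite (grad_homog0 hF) => /esym/eqP.
  by rewrite scaler_eq0 (negbTE a0) => /eqP.
have [Q Qu] := point_exists u0.
have /(vanishE hH Lw) -> : vanish H L; last by rewrite mulr0.
apply: HL; exists Q; apply/(gaussP _ _ irrF); exists (grad F' w); split=> //.
  exact: F'F.
by rewrite -/(bidual _ _ _) E; apply: hcoord_scale.
Qed.

(** At a generic zero [w] of [F'] the point [grad F' w] is a preimage under the Gauss map, and the
    chain rule describes the tangent line at its image under [A]. *)
Lemma bar_map_lin F F' A : dual_pair F F' -> A \in unitmx -> preserves F A ->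
  bar_map (curve_of F) (lin F A) = lin F' (dual_mx A).
Proof.
move=> pr uA pA; have [d [n [irrF irrF' [FF' F'F] _ _]]] := pr.
have [hF _ _ _] := irrF.
rewrite /bar_map (dual_curveE pr); apply: (rext_agree irrF').
have [c c0 Ac] := pA; have gA v := grad_dual_mx v uA Ac.
apply/(agreeP irrF'); have [j nj Hj] := generic_bidual pr.
exists (d.+2 * n.+2)%N, (subst (fun i => F'^`M(i)) F^`M(j)); split=> //.
  apply: subst_homog => [|i]; first exact: mderiv_homog.
  by apply: mderiv_homog; case: irrF'.
move=> R w Rw F'w gw S; rewrite (linmapE _ _ Rw).
have [a a0 E] := Hj w F'w gw; split.
  move=> [Q' [Q /(gaussP _ _ irrF)[v [Qv Fv Rv]]]].
  move=> /(linE irrF _ _ uA)[_ /(linmapE _ _ Qv) Q'v].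
  move=> /(gaussP _ _ irrF)[v' [Q'v' Fv' Sv']].
  have [b b0 v'E] := hcoord_unique Q'v Q'v'.
  have [b' b'0 wE] := hcoord_unique Rv Rw.
  (* [b] and [b'] compare two coordinate vectors of [Q'] and of [R]; the exponent is the degree of
     the partial derivatives. *)
  have -> : w *m dual_mx A = (b' * c^-1 * b ^- d.+2) *: grad F v'.
    rewrite wE v'E (grad_homog _ _ hF) gA -scalemxAl !scalerA; congr (_ *: _).
    by field; rewrite c0 expf_neq0.
  by apply: hcoord_scale; rewrite // !mulf_neq0 ?invr_eq0 ?expf_neq0.
move=> Sw; have w0 := hcoord_neq0 Rw.
have u0 : grad F' w != 0.
  apply: contra_neq w0 => u0; have := E; rewrite /bidual u0.
  rewrite (grad_homog0 hF) => /esym/eqP.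
  by rewrite scaler_eq0 (negbTE a0) => /eqP.
have Fu : eval F (grad F' w) = 0 by apply: F'F.
have [Q Qu] := point_exists u0.
have [Q' Q'u] := point_exists (mulmx_unit_neq0 uA u0).
exists Q'; last first.
  apply/(gaussP _ _ irrF); exists (grad F' w *m A); split=> //.
    by rewrite Ac Fu mulr0.
  rewrite gA -/(bidual _ _ _) E -scalemxAl scalerA.
  by apply: hcoord_scale; rewrite ?mulf_neq0.
exists Q; last first.
  by apply/(linE irrF _ _ uA); split; [apply/(curveE irrF Qu) | exists (grad F' w)].
apply/(gaussP _ _ irrF); exists (grad F' w); split=> //.
by rewrite -/(bidual _ _ _) E; apply: hcoord_scale.
Qed.

Lemma central_nontrivial F d P p : irreducible_form d.+3 F -> hcoord P p ->
  extendable_quasi_Galois (curve_of F) P -> exists xi,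
  [/\ xi != 0, 1%:M + xi *m p \in unitmx & preserves F (1%:M + xi *m p)].
Proof.
move=> irrF Pp [s [t [/(G0P irrF _ Pp)[xi [uA pA sE]]
  /(G0P irrF _ Pp)[eta [uB pB tE]] st]]].
have [xi0|xi0] := eqVneq xi 0; last by exists xi.
exists eta; split=> //; apply: contra_not_neq st => eta0.
by rewrite sE tE xi0 eta0.
Qed.

Section BarPoint.
Variables (F F' : {mpoly K[3]}) (P P' : pplane K) (p : 'rV[K]_3) (xi : 'cV[K]_3).
Hypotheses (FF' : dual_pair F F') (Pp : hcoord P p) (P'xi : hcoord P' xi^T).
Hypotheses (uA : 1%:M + xi *m p \in unitmx) (pA : preserves F (1%:M + xi *m p)).

Let p0 : p != 0. Proof. exact: hcoord_neq0 Pp. Qed.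
Let xi0 : xi != 0.
Proof. by rewrite -trmx_eq0; apply: hcoord_neq0 P'xi. Qed.

(** By [common_axis] the column of any element is a multiple of [xi], so all the inverse transposes
    share the centre [xi^T]. *)
Lemma bar_map_G0 sigma : G0 (curve_of F) P sigma ->
  G0 (dual_curve (curve_of F)) P' (bar_map (curve_of F) sigma).
Proof.
have [d [n [irrF irrF' _ _ _]]] := FF'.
rewrite (dual_curveE FF') => /(G0P irrF _ Pp)[eta [uB pB ->]].
rewrite (bar_map_lin FF') //; apply/(G0P irrF' _ P'xi).
have [t etaE] := common_axis charK0 irrF p0 uA pA uB pB xi0.
have n0 := central_pair_neq0 p0 uB.
have E : dual_mx (1%:M + eta *m p) =
    1%:M + (- (1 + pair p eta)^-1 * t *: p^T) *m xi^T.
  rewrite dual_mx_central // {2}etaE linearZ /= -scalemxAr -!scalemxAl.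
  by rewrite scalerA mulrC.
exists (- (1 + pair p eta)^-1 * t *: p^T); rewrite -E dual_mx_unit; split=> //.
exact: dual_preserves FF' uB pB.
Qed.

Lemma bar_map_inj sigma tau : G0 (curve_of F) P sigma -> G0 (curve_of F) P tau ->
  bar_map (curve_of F) sigma = bar_map (curve_of F) tau -> sigma = tau.
Proof.
have [d [n [irrF irrF' _ _ _]]] := FF'.
move=> /(G0P irrF _ Pp)[a [ua pa ->]] /(G0P irrF _ Pp)[b [ub pb ->]].
rewrite !(bar_map_lin FF') // => /(lin_inj irrF')[||c c0 E];
  rewrite ?dual_mx_unit //.
have := congr1 (@dual_mx K) E; rewrite dual_mxZ ?dual_mx_unit // !dual_mxK => ->.
by rewrite lin_scale // invr_eq0.
Qed.

(** For uniqueness, the image of the single nontrivial element given by [xi] already determines its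
    centre. *)
Lemma is_bar_pointP Q : is_bar_point (curve_of F) P Q <-> Q = P'.
Proof.
have [d [n [irrF irrF' _ _ _]]] := FF'.
split=> [[H _]|->]; last first.
  split=> [s Gs|s t]; first exact: bar_map_G0.
  by rewrite !inE; apply: bar_map_inj.
have [q Qq] := hcoord_exists Q; have q0 := hcoord_neq0 Qq.
have /H : G0 (curve_of F) P (lin F (1%:M + xi *m p)).
  by apply/(G0P irrF _ Pp); exists xi.
rewrite (dual_curveE FF') (bar_map_lin FF') // => /(G0P irrF' _ Qq)[eta [uB pB E]].
have n0 := central_pair_neq0 p0 uA.
have uD : dual_mx (1%:M + xi *m p) \in unitmx by rewrite dual_mx_unit.
have [c c0 BE] := lin_inj irrF' uD uB E.
move: BE; rewrite dual_mx_central //; set s := - _ => BE.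
have s0 : s != 0 by rewrite oppr_eq0 invr_eq0.
(* Otherwise a scalar matrix of rank 3 would be a sum of two matrices of rank at most 1. *)
have c1 : c = 1.
  apply/eqP; rewrite -subr_eq0; apply: contraT => c1.
  have : \rank ((c - 1)%:M : 'M[K]_3) = 3.
    apply/eqP; rewrite -[_ == _]/(row_free _) row_free_unit unitmxE det_scalar.
    by rewrite unitfE expf_neq0.
  have -> : (c - 1)%:M = eta *m q + (- (c * s) *: p^T) *m xi^T :> 'M[K]_3.
    rewrite raddfB /= -scalemx1; move/(canRL (addKr _)): BE => ->.
    rewrite scalerDr -!scalemxAl scalerA scaleNr [- 1%:M + _]addrC.
    by rewrite addrAC addrK.
  move=> rk; have := mxrank_add (eta *m q) ((- (c * s) *: p^T) *m xi^T).
  rewrite rk leqNgt => /negP[]; apply: (@leq_ltn_trans (1 + 1)) => //.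
  by apply: leq_add; apply: leq_trans (mxrankM_maxl _ _) (rank_leq_col _).
have [i pi] := row_neq0 p0.
have xq : xi^T = (eta i 0 / (s * p 0 i)) *: q.
  move: BE; rewrite c1 scale1r => /addrI/matrixP BE; apply/rowP => j.
  have := BE i j; rewrite !mxE !big_ord1 !mxE => BEij.
  by rewrite mulrAC BEij; field; rewrite pi s0.
apply: (hcoord_inj (v := xi^T)) P'xi; rewrite xq; apply: hcoord_scale Qq _.
by apply: contra_neq xi0 => a0; apply/eqP; rewrite -trmx_eq0 xq a0 scale0r.
Qed.

Lemma bar_pointE : bar_point (curve_of F) P = P'.
Proof.
rewrite /bar_point; case: xgetP => [Q _ /is_bar_pointP //|H].
by case: (H P'); apply/is_bar_pointP.
Qed.

End BarPoint.

End Duality.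

Local Close Scope ring_scope.
Local Close Scope classical_set_scope.
Unset Implicit Arguments.

Theorem theorem8p4 (K : closedFieldType) (charK0 : [pchar K]%R =i pred0)
    (d : nat) (d_ge4 : 4 <= d)
    (C : set (pplane K)) (irrC : irreducible_plane_curve d C)
    (P : pplane K) (extP : extendable_quasi_Galois C P) :
  bar_point (dual_curve C) (bar_point C P) = P /\
  group_isomorphic C (dual_curve C)
    (G0 C P) (G0 (dual_curve C) (bar_point C P)).
Proof.
case: d d_ge4 irrC => [|[|[|d]]] // _ [F irrF CE]; rewrite {}CE in extP *.
have [p Pp] := hcoord_exists P; have p0 := hcoord_neq0 Pp.
have [xi [xi0 uA pA]] := central_nontrivial irrF Pp extP.
have [F' FF'] := dual_pair_exists charK0 irrF.
have F'F := dual_pair_sym FF'.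
have xi0' : (xi^T != 0)%R by rewrite trmx_eq0.
have [P' P'xi] := point_exists xi0'.
have n0 := central_pair_neq0 p0 uA.
(* The column of the dual homology. Its transpose is a multiple of [p], so the second use of
   [bar_pointE] returns [P]. *)
pose eta := (- (1 + pair p xi)^-1 *: p^T)%R.
have dE : (dual_mx (1%:M + xi *m p) = 1%:M + eta *m xi^T)%R.
  exact: dual_mx_central.
have uD : (1%:M + eta *m xi^T)%R \in unitmx by rewrite -dE dual_mx_unit.
have pD : preserves F' (1%:M + eta *m xi^T)%R.
  by rewrite -dE; apply: dual_preserves FF' uA pA.
have Peta : hcoord P eta^T%R.
  rewrite linearZ /= trmxK; apply: hcoord_scale => //.
  by rewrite oppr_eq0 invr_eq0.
rewrite (bar_pointE charK0 FF' Pp P'xi uA pA) (dual_curveE FF').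
rewrite (bar_pointE charK0 F'F P'xi Peta uD pD); split=> //.
have FGF' := bar_map_G0 charK0 FF' Pp P'xi uA pA.
have F'GF := bar_map_G0 charK0 F'F P'xi Peta uD pD.
rewrite (dual_curveE FF') in FGF'; rewrite (dual_curveE F'F) in F'GF.
have [_ [n [_ irrF' _ _ _]]] := FF'.
exists (bar_map (curve_of F)); first split.
- by move=> s Gs; apply: FGF'.
- by move=> s t; rewrite !inE; apply: (bar_map_inj FF' Pp).
(* The map built from the dual curve is an inverse, because [dual_mx] is an involution. *)
- move=> t Gt; exists (bar_map (curve_of F') t); first exact: F'GF.
  move: Gt => /(G0P irrF' _ P'xi)[b [ub pb ->]].
  rewrite (bar_map_lin F'F) // (bar_map_lin FF') ?dual_mx_unit ?dual_mxK //.
  exact: dual_preserves F'F ub pb.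
- move=> s t /(G0P irrF _ Pp)[a [ua pa ->]] /(G0P irrF _ Pp)[b [ub pb ->]].
  rewrite (rcomp_lin irrF) // (bar_map_lin FF') ?unitmx_mul ?ua ?ub //;
    last exact: preserves_mul.
  rewrite !(bar_map_lin FF') // dual_mxM // (rcomp_lin irrF') ?dual_mx_unit //.
  exact: dual_preserves FF' ub pb.
Qed.
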